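(* Consider the probability space $(L(\mathbb B_\infty),\mathrm{tr}_\infty)$ equipped with the representation $\rho:\mathbb B_\infty\to\mathrm{Aut}(L(\mathbb B_\infty),\mathrm{tr}_\infty)$ given by $\rho(\tau):=\mathrm{Ad}\,L_\tau$. Then: (i) $\rho$ has the generating property. (ii) $L(\mathbb B_\infty)^{\rho(\mathbb B_\infty)}\simeq\mathbb C$. (iii) $L(\mathbb B_\infty)^{\rho(\mathbb B_{n+2,\infty})}=L(\mathbb B_{n+1})$ for all $n\ge0$. (iv) The map $\alpha(x):=\lim_{n\to\infty}\rho(\sigma_1\sigma_2\cdots\sigma_n)(x)$ (limit in the strong operator topology) is an endomorphism for $(L(\mathbb B_\infty),\mathrm{tr}_\infty)$ such that $\alpha(L_\tau)=L_{\mathrm{sh}(\tau)}$ for $\tau\in\mathbb B_\infty$. (v) Each cell of the triangular tower of inclusions $$\begin{matrix} \mathbb C&\subset&\mathbb C&\subset&L(\mathbb B_2)&\subset&L(\mathbb B_3)&\subset&L(\mathbb B_4)&\subset\cdots\subset&L(\mathbb B_\infty)\\ &&\cup&&\cup&&\cup&&\cup&&\cup\\ &&\mathbb C&\subset&\mathbb C&\subset&\alpha(L(\mathbb B_2))&\subset&\alpha(L(\mathbb B_3))&\subset\cdots\subset&\alpha(L(\mathbb B_\infty))\\ &&&&\cup&&\cup&&\cup&&\cup\\ &&&&\mathbb C&\subset&\mathbb C&\subset&\alpha^2(L(\mathbb B_2))&\subset\cdots\subset&\alpha^2(L(\mathbb B_\infty))\\ &&&&&&\cup&&\cup&&\cup\\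 &&&&&&\vdots&&\vdots&&\vdots \end{matrix}$$ is a commuting square. (vi) The maps $\iota_n^{(\alpha)}:=\alpha^n|_{L(\mathbb B_2)}$, $n\in\mathbb N_0$, define a stationary and full $\mathbb C$-independent random sequence $\iota^{(\alpha)}$ from $(L(\mathbb B_2),\mathrm{tr}_2)$ to $(L(\mathbb B_\infty),\mathrm{tr}_\infty)$. In other words, $\alpha$ is a full Bernoulli shift over $\mathbb C$ with generator $L(\mathbb B_2)$. (vii) The random sequence $\iota^{(\alpha)}$ is not spreadable.
   Context: $\mathbb B_\infty$ is the infinite braid group, generated by $\sigma_1,\sigma_2,\dots$ subject to $\sigma_i\sigma_j\sigma_i=\sigma_j\sigma_i\sigma_j$ if $|i-j|=1$ and $\sigma_i\sigma_j=\sigma_j\sigma_i$ if $|i-j|>1$; $\mathbb B_n=\langle\sigma_1,\dots,\sigma_{n-1}\rangle$ ($\mathbb B_1$ trivial) and $\mathbb B_{n,\infty}=\langle\sigma_k\mid k\ge n\rangle$. The shift $\mathrm{sh}$ is the endomorphism of $\mathbb B_\infty$ with $\mathrm{sh}(\sigma_n)=\sigma_{n+1}$ for all $n\in\mathbb N$. $L(\mathbb B_\infty)$ is the group von Neumann algebra generated by the left regular representation $\sigma\mapsto L_\sigma$ on $\ell^2(\mathbb B_\infty)$, $\mathrm{tr}_\infty$ its canonical faithful normal tracial state ($\mathrm{tr}_\infty(L_\sigma)=1$ if $\sigma$ is the unit, $0$ otherwise), $L(\mathbb B_n)\subset L(\mathbb B_\infty)$ the von Neumann subalgebra generated by $L_\sigma$,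 $\sigma\in\mathbb B_n$, and $\mathrm{tr}_n$ the restriction of $\mathrm{tr}_\infty$ to it. $\mathrm{Ad}\,u=u\,\cdot\,u^*$. Superscripts $\rho(G)$ denote fixed point algebras of $\rho(G)$. $\rho$ has the generating property if $L(\mathbb B_\infty)$ is generated as a von Neumann algebra by the algebras $L(\mathbb B_\infty)^{\rho(\mathbb B_{n,\infty})}$, $n\in\mathbb N$. For a von Neumann subalgebra $\mathcal B$, $E_{\mathcal B}$ denotes the trace-preserving conditional expectation onto $\mathcal B$. A square of inclusions with top row $\mathcal N_2\subset\mathcal P$ and bottom row $\mathcal N\subset\mathcal N_1$ is a commuting square if $E_{\mathcal N_1}E_{\mathcal N_2}=E_{\mathcal N}$. Cells of the tower are the squares formed by two consecutive rows and two consecutive columns, and also those formed with the rightmost column. For a sequence $(\iota_n)_{n\in\mathbb N_0}$ of trace-preserving injective $*$-homomorphisms (random variables) from $(\mathcal A_0,\varphi_0)$ to $(\mathcal A,\varphi)$, and $\mathbf i:\{1,\dots,n\}\to\mathbb N_0$, put $\varphi_\iota[\mathbf i;\mathbf a]=\varphi(\iota_{\mathbf i(1)}(a_1)\cdots\iota_{\mathbf i(n)}(a_n))$. The sequence is stationary if $\varphi_\iota[\mathbf i;\cdot]=\varphi_\iota[\mathbf j;\cdot]$ whenever $\mathbf i=\mathbf j+k$ for some $k\in\mathbb N_0$; spreadable if $\varphi_\iota[\mathbf i;\cdot]=\varphi_\iota[\mathbf j;\cdot]$ whenever $\mathbf i=\pi\circ\mathbf j$ for a finite permutation $\pi$ of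 $\mathbb N_0$ that is order preserving on the range of $\mathbf j$; full $\mathbb C$-independent if $\varphi(xy)=\varphi(x)\varphi(y)$ for all $x\in\bigvee_{i\in I}\iota_i(\mathcal A_0)$, $y\in\bigvee_{j\in J}\iota_j(\mathcal A_0)$ and all disjoint $I,J\subset\mathbb N_0$ ($\bigvee$ = generated von Neumann algebra). An endomorphism $\alpha$ (restricted to $\bigvee_n\alpha^n(\mathcal B_0)$) is a full Bernoulli shift over $\mathbb C$ with generator $\mathcal B_0$ if the family $(\alpha^n(\mathcal B_0))_{n\in\mathbb N_0}$ is full $\mathbb C$-independent in this sense. *)

(* Defs.v *)
From HB Require Import structures.
From mathcomp Require Import all_boot all_order all_algebra.
From mathcomp Require Import all_classical all_reals all_analysis.
From mathcomp Require Import complex lra.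

Set Implicit Arguments.
Unset Strict Implicit.
Unset Printing Implicit Defensive.

Import Order.TTheory GRing.Theory Num.Theory.
Import numFieldNormedType.Exports.

Local Open Scope classical_set_scope.
Local Open Scope ring_scope.
Local Open Scope complex_scope.

Section BraidGroup.
Local Open Scope quotient_scope.
Local Open Scope group_scope.

(* A letter (k, false) stands for sigma_(k+1), and (k, true) for its inverse:
   the generators are numbered from 0 here and from 1 in the mathematics. *)
Definition braid_word : Type := seq (nat * bool).

Inductive braid_eq : braid_word -> braid_word -> Prop :=
| braid_eq_refl u : braid_eq u u
| braid_eq_sym u v : braid_eq u v -> braid_eq v u
| braid_eq_trans v u w : braid_eq u v -> braid_eq v w -> braid_eq u w
| braid_eq_ctx a b u v :
    braid_eq u v -> braid_eq (a ++ u ++ b)%SEQ (a ++ v ++ b)%SEQ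
| braid_eq_cancel k e : braid_eq [:: (k, e); (k, ~~ e)] [::]
| braid_eq_braid k :
    braid_eq [:: (k, false); (k.+1, false); (k, false)]
             [:: (k.+1, false); (k, false); (k.+1, false)]
| braid_eq_comm k l : (k.+1 < l)%N ->
    braid_eq [:: (k, false); (l, false)] [:: (l, false); (k, false)].

Definition braid_eqb (u v : braid_word) : bool := `[< braid_eq u v >].

Lemma braid_eqb_refl : reflexive braid_eqb.
Proof. by move=> u; apply/asboolP/braid_eq_refl. Qed.

Lemma braid_eqb_sym : symmetric braid_eqb.
Proof. by move=> u v; apply/asboolP/asboolP => /braid_eq_sym. Qed.

Lemma braid_eqb_trans : transitive braid_eqb.
Proof.
by move=> v u w /asboolP uv /asboolP vw; apply/asboolP/(braid_eq_trans uv vw).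
Qed.

Canonical braid_equiv :=
  EquivRel braid_eqb braid_eqb_refl braid_eqb_sym braid_eqb_trans.

Definition braid : Type := {eq_quot braid_equiv}.

HB.instance Definition _ := Choice.copy braid {eq_quot braid_equiv}.
HB.instance Definition _ := EqQuotient.copy braid {eq_quot braid_equiv}.

Definition braid_class (u : braid_word) : braid := \pi_braid u.

Lemma braid_classP u v : braid_eq u v <-> braid_class u = braid_class v.
Proof.
rewrite /braid_class; split=> [uv|/eqmodP /asboolP//].
by apply/eqmodP/asboolP.
Qed.

Lemma braid_eq_repr u : braid_eq (repr (braid_class u)) u.
Proof. by apply/braid_classP; rewrite /braid_class reprK. Qed.

Definition inv_word (u : braid_word) : braid_word :=
  rev [seq (x.1, ~~ x.2) | x <- u].

Definition shift_word (u : braid_word) : braid_word :=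
  [seq (x.1.+1, x.2) | x <- u].

Lemma braid_eq_cat u u' v v' :
  braid_eq u u' -> braid_eq v v' -> braid_eq (u ++ v)%SEQ (u' ++ v')%SEQ.
Proof.
move=> uu' vv'; apply: (@braid_eq_trans (u' ++ v)%SEQ).
  by have := braid_eq_ctx [::] v uu'.
by have := braid_eq_ctx u' [::] vv'; rewrite !cats0.
Qed.

Lemma inv_word_cat u v : inv_word (u ++ v)%SEQ = (inv_word v ++ inv_word u)%SEQ.
Proof. by rewrite /inv_word map_cat rev_cat. Qed.

Lemma inv_wordK : involutive inv_word.
Proof.
move=> u; rewrite /inv_word map_rev revK -map_comp -[RHS]map_id.
by apply: eq_map => -[k e] /=; rewrite negbK.
Qed.

Lemma braid_eq_wordV u : braid_eq (u ++ inv_word u)%SEQ [::].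
Proof.
elim: u => [|[k e] u IH]; first exact: braid_eq_refl.
rewrite -cat1s inv_word_cat -catA (catA u).
apply: (@braid_eq_trans [:: (k, e); (k, ~~ e)]).
  exact: (braid_eq_ctx [:: (k, e)] (inv_word [:: (k, e)]) IH).
exact: braid_eq_cancel.
Qed.

Lemma braid_eq_Vword u : braid_eq (inv_word u ++ u)%SEQ [::].
Proof. by have := braid_eq_wordV (inv_word u); rewrite inv_wordK. Qed.

Lemma braid_eq_inv u v : braid_eq u v -> braid_eq (inv_word u) (inv_word v).
Proof.
move=> uv.
apply: (@braid_eq_trans (inv_word u ++ (v ++ inv_word v))%SEQ).
  rewrite -{1}(cats0 (inv_word u)); apply: braid_eq_cat.
    exact: braid_eq_refl.
  exact/braid_eq_sym/braid_eq_wordV.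
rewrite catA; apply: (braid_eq_cat (u' := [::]) (v' := inv_word v)).
  apply: braid_eq_trans (braid_eq_Vword u).
  by apply: braid_eq_cat; [exact: braid_eq_refl|exact: braid_eq_sym].
exact: braid_eq_refl.
Qed.

Definition braid_one : braid := braid_class [::].
Definition braid_mul (x y : braid) : braid := braid_class (repr x ++ repr y)%SEQ.
Definition braid_inv (x : braid) : braid := braid_class (inv_word (repr x)).

Lemma braid_mulE u v :
  braid_mul (braid_class u) (braid_class v) = braid_class (u ++ v)%SEQ.
Proof. by apply/braid_classP/braid_eq_cat; exact: braid_eq_repr. Qed.

Lemma braid_invE u : braid_inv (braid_class u) = braid_class (inv_word u).
Proof. exact/braid_classP/braid_eq_inv/braid_eq_repr. Qed.

Lemma braid_classK (x : braid) : braid_class (repr x) = x.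
Proof. by rewrite /braid_class reprK. Qed.

Lemma braid_mulA : associative braid_mul.
Proof.
move=> x y z; rewrite -[x]braid_classK -[y]braid_classK -[z]braid_classK.
by rewrite !braid_mulE catA.
Qed.

Lemma braid_mul1 : left_id braid_one braid_mul.
Proof. by move=> x; rewrite -[x]braid_classK braid_mulE. Qed.

Lemma braid_mulr1 : right_id braid_one braid_mul.
Proof. by move=> x; rewrite -[x]braid_classK braid_mulE cats0. Qed.

Lemma braid_mulV : left_inverse braid_one braid_inv braid_mul.
Proof.
move=> x; rewrite -[x]braid_classK braid_invE braid_mulE.
exact/braid_classP/braid_eq_Vword.
Qed.

Lemma braid_mulrV : right_inverse braid_one braid_inv braid_mul.
Proof.
move=> x; rewrite -[x]braid_classK braid_invE braid_mulE.
exact/braid_classP/braid_eq_wordV.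
Qed.

HB.instance Definition _ := isGroup.Build braid
  braid_mulA braid_mul1 braid_mulr1 braid_mulV braid_mulrV.

(* sigma k is the Artin generator sigma_(k+1). *)
Definition sigma (k : nat) : braid := braid_class [:: (k, false)].

Definition sh (x : braid) : braid := braid_class (shift_word (repr x)).

Lemma braid_eq_shift u v :
  braid_eq u v -> braid_eq (shift_word u) (shift_word v).
Proof.
elim=> {u v} [u|u v _ IH|v u w _ IH1 _ IH2|a b u v _ IH|k e|k|k l kl].
- exact: braid_eq_refl.
- exact: braid_eq_sym.
- exact: braid_eq_trans IH1 IH2.
- by rewrite /shift_word !map_cat; exact: braid_eq_ctx.
- exact: braid_eq_cancel.
- exact: braid_eq_braid.
- exact: braid_eq_comm.
Qed.

Lemma shE u : sh (braid_class u) = braid_class (shift_word u).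
Proof. exact/braid_classP/braid_eq_shift/braid_eq_repr. Qed.

Lemma sh_sigma k : sh (sigma k) = sigma k.+1.
Proof. exact: shE. Qed.

Lemma sh_monoid_morphism : monoid.monoid_morphism sh.
Proof.
split=> [|x y]; first exact: shE.
have -> : x * y = braid_class (repr x ++ repr y)%SEQ by [].
by rewrite shE /shift_word map_cat; exact: esym (braid_mulE _ _).
Qed.

HB.instance Definition _ :=
  isUMagmaMorphism.Build braid braid sh sh_monoid_morphism.

End BraidGroup.

Section EllTwo.
Variables (R : realType) (G : choiceType).
Local Notation C := R[i].
Implicit Types f g : G -> C.

Definition sqsummable f : Prop :=
  (\esum_(x in [set: G]) (Normc.normc (f x) ^+ 2)%:E < +oo)%E.

Definition sqsummable_pred : {pred G -> C} := fun f => `[< sqsummable f >].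

Lemma sqsummable_submod_closed : submod_closed sqsummable_pred.
Proof.
split=> [|a u v].
  apply/asboolP; rewrite /sqsummable esum1 ?ltry// => x _.
  by rewrite Normc.normc0 expr0n.
move=> /asboolP su /asboolP sv; apply/asboolP.
have n0 (z : C) : (0 <= (Normc.normc z ^+ 2)%:E :> \bar R)%E.
  by rewrite lee_fin sqr_ge0.
have nn (z : C) : 0 <= Normc.normc z :> R by case: z => x y; exact: sqrtr_ge0.
pose k := 2 * Normc.normc a ^+ 2.
have k0 : 0 <= k by rewrite mulr_ge0// sqr_ge0.
have esumZ (c : R) (h : G -> C) : 0 <= c -> sqsummable h ->
    (\esum_(x in [set: G]) (c * Normc.normc (h x) ^+ 2)%:E < +oo)%E.
  move=> c0 sh; apply: (@le_lt_trans _ _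
      (c%:E * \esum_(x in [set: G]) (Normc.normc (h x) ^+ 2)%:E)%E); last first.
    move: sh; rewrite /sqsummable.
    have : (0 <= \esum_(x in [set: G]) (Normc.normc (h x) ^+ 2)%:E)%E.
      by apply: esum_ge0.
    by case: (\esum_(x in _) _)%E => //= r _ _; rewrite -EFinM ltry.
  apply: ge_ereal_sup => _ [A [finA _] <-].
  rewrite (eq_fsbigr (fun x => c%:E * (Normc.normc (h x) ^+ 2)%:E)%E); last first.
    by move=> x _; rewrite EFinM.
  rewrite -ge0_mule_fsumr//; apply: lee_pmul => //.
    by apply: fsume_ge0.
  by apply: esum_ge; exists A.
apply: (@le_lt_trans _ _ (\esum_(x in [set: G])
   ((k * Normc.normc (u x) ^+ 2)%:E + (2 * Normc.normc (v x) ^+ 2)%:E))%E).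
  apply: le_esum => x _; rewrite -EFinD lee_fin /=.
  have le1 : Normc.normc ((a *: u + v) x) <=
      Normc.normc a * Normc.normc (u x) + Normc.normc (v x).
    by rewrite -Normc.normcM; exact: le_normcD.
  apply: (@le_trans _ _ ((Normc.normc a * Normc.normc (u x) + Normc.normc (v x)) ^+ 2)).
    by rewrite ler_pXn2r// nnegrE ?addr_ge0 ?mulr_ge0.
  rewrite /k; set p := Normc.normc a; set q := Normc.normc (u x).
  set r := Normc.normc (v x).
  rewrite -subr_ge0 (_ : _ - _ = (p * q - r) ^+ 2) ?sqr_ge0//.
  by rewrite sqrrB sqrrD !mulr2n !exprMn !mulrDl !mul1r; lra.
rewrite esumD => [|x _|x _]; rewrite ?lee_fin ?mulr_ge0 ?sqr_ge0//.
by rewrite lte_add_pinfty// esumZ.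
Qed.

HB.instance Definition _ := GRing.isSubmodClosed.Build C (G -> C)
  sqsummable_pred sqsummable_submod_closed.

Record l2 := L2 {l2_fun :> G -> C; l2_funP : l2_fun \in sqsummable_pred}.

HB.instance Definition _ := [isSub for l2_fun].
HB.instance Definition _ := [Choice of l2 by <:].
HB.instance Definition _ := [SubChoice_isSubLmodule of l2 by <:].

End EllTwo.

(* The sum of an absolutely summable family, without ordering the index set;
   values on other families are junk. *)
Definition rsum (R : realType) (G : choiceType) (f : G -> R) : R :=
  fine (\esum_(x in [set: G]) (Num.max (f x) 0)%:E) -
  fine (\esum_(x in [set: G]) (Num.max (- f x) 0)%:E).

Definition csum (R : realType) (G : choiceType) (f : G -> R[i]) : R[i] :=
  rsum (fun x => complex.Re (f x)) +i* rsum (fun x => complex.Im (f x)).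

Section Operators.
Variables (R : realType) (G : choiceType).
Local Notation C := R[i].
Local Notation H := (l2 R G).
Local Notation op := (H -> H).

(* Linear in the first argument. *)
Definition inner (u v : H) : C := csum (fun x => u x * (v x)^*%C).

Definition norm2 (u : H) : R :=
  Num.sqrt (fine (\esum_(x in [set: G]) (Normc.normc (u x) ^+ 2)%:E)).

Definition bounded_ops : set op :=
  [set T | linear T /\ exists M : R, forall u, norm2 (T u) <= M * norm2 u].

(* The Hilbert space adjoint; it exists and is unique for T in bounded_ops. *)
Definition adjoint (T : op) : op :=
  xget (0 : op) [set S : op | forall u v, inner (T u) v = inner u (S v)].

Definition positive_op (T : op) : Prop := forall u, 0 <= inner (T u) u.

Definition commutant (M : set op) : set op :=
  [set T | bounded_ops T /\ forall S, M S -> T \o S = S \o T].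

Definition von_neumann (M : set op) : Prop :=
  [/\ M `<=` bounded_ops,
      forall T, M T -> M (adjoint T) &
      commutant (commutant M) = M].

Definition vN_generated (A : set op) : set op := smallest von_neumann A.

Definition scalar_ops : set op := [set T | exists c : C, T = (fun u => c *: u)].

Definition sot_cvg (T : nat -> op) (S : op) : Prop :=
  forall u, norm2 (T n u - S u) @[n --> \oo] --> (0 : R).

Definition sot_lim (T : nat -> op) : op :=
  xget (0 : op) [set S | sot_cvg T S].

Section ProbabilitySpaces.
Variable tr : op -> C.

Definition star_hom (A B : set op) (f : op -> op) : Prop :=
  [/\ forall x, A x -> B (f x),
      forall (c : C) x y, A x -> A y -> f (c *: x + y) = c *: f x + f y,
      forall x y, A x -> A y -> f (x \o y) = f x \o f y &
      forall x, A x -> f (adjoint x) = adjoint (f x)].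

Definition random_variable (A B : set op) (f : op -> op) : Prop :=
  [/\ star_hom A B f, {in A &, injective f} & forall x, A x -> tr (f x) = tr x].

Definition endomorphism (A : set op) (f : op -> op) : Prop :=
  random_variable A A f /\ f idfun = idfun.

Definition automorphism (A : set op) (f : op -> op) : Prop :=
  endomorphism A f /\ f @` A = A.

Definition cond_exp (A B : set op) (E : op -> op) : Prop :=
  [/\ (forall x, A x -> B (E x)) /\ (forall x, B x -> E x = x),
      forall (c : C) x y, A x -> A y -> E (c *: x + y) = c *: E x + E y,
      forall a x b, B a -> A x -> B b -> E (a \o x \o b) = a \o E x \o b,
      forall x, A x -> positive_op x -> positive_op (E x) &
      forall x, A x -> tr (E x) = tr x].

(* The square with top row N2 `<=` P and bottom row N `<=` N1. *)
Definition commuting_square (N2 P N N1 : set op) : Prop :=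
  [/\ [/\ von_neumann P, von_neumann N1, von_neumann N2 & von_neumann N],
      [/\ N2 `<=` P, N1 `<=` P, N `<=` N2 & N `<=` N1] &
      exists E1 E2 E : op -> op,
        [/\ cond_exp P N1 E1, cond_exp P N2 E2, cond_exp P N E &
            forall x, P x -> E1 (E2 x) = E x]].

Definition full_independent (F : nat -> set op) : Prop :=
  forall I J : set nat, I `&` J = set0 ->
  forall x y, vN_generated (\bigcup_(i in I) F i) x ->
    vN_generated (\bigcup_(j in J) F j) y ->
    tr (x \o y) = tr x * tr y.

Definition random_sequence (A0 A : set op) (iota : nat -> op -> op) : Prop :=
  forall n, random_variable A0 A (iota n).

(* tr (iota_(i 0) (a 0) \o ... \o iota_(i (n - 1)) (a (n - 1))) *)
Definition moment (iota : nat -> op -> op) n (i : 'I_n -> nat)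
    (a : 'I_n -> op) : C :=
  tr (\big[comp/idfun]_(k < n) iota (i k) (a k)).

Definition stationary (A0 : set op) (iota : nat -> op -> op) : Prop :=
  forall n (i j : 'I_n -> nat) (k : nat), (forall l, i l = (j l + k)%N) ->
  forall a : 'I_n -> op, (forall l, A0 (a l)) ->
    moment iota i a = moment iota j a.

Definition finite_permutation (p : nat -> nat) : Prop :=
  bijective p /\ exists N, forall k, (N <= k)%N -> p k = k.

Definition spreadable (A0 : set op) (iota : nat -> op -> op) : Prop :=
  forall n (i j : 'I_n -> nat) (p : nat -> nat), finite_permutation p ->
  (forall k l, (j k < j l)%N -> (p (j k) < p (j l))%N) ->
  (forall l, i l = p (j l)) ->
  forall a : 'I_n -> op, (forall l, A0 (a l)) ->
    moment iota i a = moment iota j a.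

Definition full_bernoulli_shift (B0 : set op) (f : op -> op) : Prop :=
  endomorphism (vN_generated (\bigcup_n (iter n f @` B0))) f /\
  full_independent (fun n => iter n f @` B0).

End ProbabilitySpaces.
End Operators.

Section GroupVonNeumannAlgebra.
Variables (R : realType) (G : groupType).
Local Notation C := R[i].
Local Notation op := (l2 R G -> l2 R G).

Definition delta_fun (s : G) : G -> C := fun x => (x == s)%:R.

Lemma delta_subproof s : delta_fun s \in @sqsummable_pred R G.
Proof.
apply/asboolP; rewrite /sqsummable (esumID [set s]); last first.
  by move=> x _; rewrite lee_fin sqr_ge0.
rewrite !setTI [X in (_ + X)%E]esum1 ?adde0; last first.
  move=> x /eqP xs; rewrite /delta_fun (negbTE xs).
  by rewrite Normc.normc0 expr0n.
by rewrite esum_set1 ?ltry// lee_fin sqr_ge0.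
Qed.

Definition delta (s : G) : l2 R G := L2 (delta_subproof s).

Definition left_translation_fun (s : G) (f : G -> C) : G -> C :=
  fun x => f (s^-1 * x)%g.

Lemma left_translation_subproof s (u : l2 R G) :
  left_translation_fun s u \in @sqsummable_pred R G.
Proof.
have /asboolP su := l2_funP u; apply/asboolP; move: su.
rewrite /sqsummable /left_translation_fun.
rewrite (reindex_esum [set: G] [set: G] (fun x => (s^-1 * x)%g))//.
split=> // [x y _ _ /mulgI//|y _]; exists (s * y)%g => //.
by rewrite mulgA mulVg mul1g.
Qed.

(* L_s maps delta t to delta (s * t). *)
Definition left_regular (s : G) : op :=
  fun u => L2 (left_translation_subproof s u).

Definition canonical_trace (x : op) : C := inner (x (delta 1%g)) (delta 1%g).

Definition subgroup_set (K : set G) : Prop :=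
  [/\ K 1%g, forall s t, K s -> K t -> K (s * t)%g &
      forall s, K s -> K (s^-1)%g].

Definition generated_subgroup (S : set G) : set G := smallest subgroup_set S.

Definition group_vN (K : set G) : set op := vN_generated (left_regular @` K).

Definition Ad (w : op) : op -> op := fun x => w \o x \o adjoint w.

Definition Ad_left (s : G) : op -> op := Ad (left_regular s).

Definition fixed_algebra (A : set op) (rho : G -> op -> op) (K : set G) :
    set op :=
  [set x | A x /\ forall s, K s -> rho s x = x].

End GroupVonNeumannAlgebra.

Arguments Ad_left {R G}.
Arguments canonical_trace {R G}.
Arguments group_vN R {G}.

Section BraidGroupAlgebra.
Variable R : realType.
Local Notation op := (l2 R braid -> l2 R braid).

(* B_n, generated by sigma_1, ..., sigma_(n-1). *)
Definition braid_sub (n : nat) : set braid :=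
  generated_subgroup (sigma @` [set k | (k.+1 < n)%N]).

(* B_(n,oo), generated by the sigma_j with j >= n. *)
Definition braid_tail (n : nat) : set braid :=
  generated_subgroup (sigma @` [set k | (n <= k.+1)%N]).

Definition LBoo : set op := group_vN R [set: braid].

Definition LB (n : nat) : set op := group_vN R (braid_sub n).

Definition representation (A : set op) (rho : braid -> op -> op) : Prop :=
  (forall s, automorphism canonical_trace A (rho s)) /\
  forall s t x, A x -> rho (s * t)%g x = rho s (rho t x).

Definition generating_property (rho : braid -> op -> op) : Prop :=
  vN_generated
    (\bigcup_(n in [set n | (0 < n)%N]) fixed_algebra LBoo rho (braid_tail n))
  = LBoo.

Definition alpha_approx (x : op) (n : nat) : op :=
  Ad_left (\big[*%g/1%g]_(k < n) sigma k) x.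

Definition alpha (x : op) : op := sot_lim (alpha_approx x).

Definition alpha_image (k : nat) (A : set op) : set op := iter k alpha @` A.

(* The k-th row of the tower is alpha^k (L(B_0)), alpha^k (L(B_1)), ..., with
   L(B_0) = L(B_1) = C, and alpha^k (L(B_m)) stands in column k + m. *)
Definition tower_cell (k m : nat) : Prop :=
  commuting_square canonical_trace
    (alpha_image k (LB m.+1)) (alpha_image k (LB m.+2))
    (alpha_image k.+1 (LB m)) (alpha_image k.+1 (LB m.+1)).

Definition tower_right_cell (k m : nat) : Prop :=
  commuting_square canonical_trace
    (alpha_image k (LB m.+1)) (alpha_image k LBoo)
    (alpha_image k.+1 (LB m)) (alpha_image k.+1 LBoo).

End BraidGroupAlgebra.

Arguments LBoo R : clear implicits.
Arguments LB R n : clear implicits.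

(* Main.v *)
Require Import Defs.
From HB Require Import structures.
From mathcomp Require Import all_boot all_order all_algebra.
From mathcomp Require Import all_classical all_reals all_analysis.
From mathcomp Require Import complex.
From mathcomp Require finmap.
From mathcomp Require Import zify ring lra.

Set Implicit Arguments.
Unset Strict Implicit.
Unset Printing Implicit Defensive.

Import Order.TTheory GRing.Theory Num.Theory.
Import numFieldNormedType.Exports.

(** Let G be a group and K a subgroup.  The von Neumann algebra L(K) acting on
    l^2(G) consists of the bounded operators x that commute with all right
    translations and whose coefficient function g |-> (x delta_1)(g) vanishes
    outside K ([group_vNP]).  An element of L(G) is therefore a function on G,
    and each assertion turns into one about the braid group.

    Conjugation by L_s conjugates the argument of the coefficient function, so
    a fixed point of a subgroup acting in this way has a coefficient function
    that is constant on orbits; being square summable, it vanishes on infinite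
    orbits ([level_set_finite]).  The conditional expectation onto L(K)
    multiplies the coefficient function by the indicator of K.  It is realized
    by cutting an operator down to its diagonal blocks along the right cosets
    of K ([group_expectation]), which makes boundedness, positivity and the
    bimodule property visible, and it follows that intersections of subgroups
    give commuting squares ([group_vN_commuting_square]).  The trace reads off
    the coefficient at 1, so it is multiplicative on x y when x and y are
    supported in subgroups with trivial intersection
    ([trace_comp_independent]).

    The endomorphism alpha pushes coefficient functions forward along the shift
    of the braid group.  The operators Ad(L_(s_1 ... s_n)) x are uniformly
    bounded, they are determined by their values at delta_1, and there they
    permute the coefficients of x in such a way that each one is eventually at
    rest, because s_1 ... s_n conjugates t to its shift for n large.  Hence they
    form a Cauchy sequence at every vector, and completeness of l^2 gives the
    limit ([Ad_limit]).  The same statement for the inverse conjugations shows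
    that alpha maps L(K) onto L(sh K) ([alpha_group_vN]).

    What is needed from the braid group comes from deleting a strand: one
    follows the strand starting at a given position through a braid word and
    erases the crossings in which it takes part ([delete_strand]).  This
    respects the braid relations ([delete_strand_eq]).  Deleting the first
    strand shows that a braid in a parabolic subgroup that is also a shift
    belongs to the parabolic subgroup without s_1 ([parabolic_range_sh]); all
    intersections of parabolic subgroups used below come from this.  If both x
    and s_n x s_n^-1 lie in the group generated by s_1, ..., s_(n-1), deleting
    the last strand of the conjugate shows that x lies in the group generated
    by s_1, ..., s_(n-2) ([sigma_conj_drop]); applied to a finite orbit under
    conjugation by the s_k with k >= n + 2, this forces the orbit into the
    group generated by s_1, ..., s_n ([fixed_algebra_tail]).

    Finally, the relation s_1 s_2 s_1 = s_2 s_1 s_2 is an equation between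
    moments of the sequence, and it fails when s_2 is replaced by s_3
    ([iter_alpha_not_spreadable]). *)

Local Open Scope classical_set_scope.

(** * Deleting a strand of a braid word *)

Section Strands.
Local Open Scope nat_scope.

(** Positions are counted from 0, and the letter of index [k] exchanges the
    positions [k] and [k.+1]. *)
Definition cross (k p : nat) : nat :=
  if p == k then k.+1 else if p == k.+1 then k else p.

Fixpoint strand_end (p : nat) (u : braid_word) : nat :=
  if u is x :: v then strand_end (cross x.1 p) v else p.

Definition delete_letter (p : nat) (x : nat * bool) : braid_word :=
  if p < x.1 then [:: (x.1.-1, x.2)]
  else if x.1.+1 < p then [:: x] else [::].

Fixpoint delete_strand (p : nat) (u : braid_word) : braid_word :=
  if u is x :: v then delete_letter p x ++ delete_strand (cross x.1 p) v
  else [::].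

Lemma strand_end_cat p u v :
  strand_end p (u ++ v) = strand_end (strand_end p u) v.
Proof. by elim: u p => //= x u IH p; rewrite IH. Qed.

Lemma delete_strand_cat p u v :
  delete_strand p (u ++ v) =
  delete_strand p u ++ delete_strand (strand_end p u) v.
Proof. by elim: u p => //= x u IH p; rewrite IH catA. Qed.

Ltac decide_tests := rewrite /= /cross /delete_letter /=;
  repeat match goal with
  | |- context [if @eq_op ?T ?a ?b then _ else _] =>
      first [have -> : (@eq_op T a b) = true by lia
            |have -> : (@eq_op T a b) = false by lia]
  | |- context [if leq ?a ?b then _ else _] =>
      first [have -> : (leq a b) = true by lia
            |have -> : (leq a b) = false by lia]
  end; rewrite /=.

(** The end point of a strand depends only on the permutation underlying the
    braid; the relations are checked for each position of the strand relative
    to the crossings involved. *)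
Lemma strand_end_eq u v : braid_eq u v ->
  forall p, strand_end p u = strand_end p v.
Proof.
elim=> {u v} [//|u v _ IH p|v u w _ IH1 _ IH2 p|a b u v _ IH p|k e p|k p|k l kl
  p].
- by rewrite IH.
- by rewrite IH1.
- by rewrite !strand_end_cat IH.
- have [pk|[pk|[pk|pk]]] : p < k \/ p = k \/ p = k.+1 \/ k.+1 < p by lia.
  1-4: by decide_tests; lia.
- have [pk|[pk|[pk|[pk|pk]]]] :
    p < k \/ p = k \/ p = k.+1 \/ p = k.+2 \/ k.+2 < p by lia.
  1-5: by decide_tests; lia.
- have [pk|[pk|[pk|[pk|[pk|[pk|pk]]]]]] : p < k \/ p = k \/ p = k.+1 \/
      k.+1 < p < l \/ p = l \/ p = l.+1 \/ l.+1 < p by lia.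
  1-7: by decide_tests; lia.
Qed.

(** Erasing a strand from either side of a relation leaves the same word, or
    again the two sides of a relation.  This makes strand deletion well defined
    on braids once the initial position is fixed. *)
Lemma delete_strand_eq u v : braid_eq u v ->
  forall p, braid_eq (delete_strand p u) (delete_strand p v).
Proof.
elim=> {u v} [u p|u v _ IH p|v u w _ IH1 _ IH2 p|a b u v uv IH p|k e p|k p|k l
  kl p].
- exact: braid_eq_refl.
- exact: braid_eq_sym.
- exact: braid_eq_trans (IH1 p) (IH2 p).
- rewrite !delete_strand_cat (strand_end_eq uv); apply: braid_eq_ctx; exact: IH.
- have [pk|[pk|[pk|pk]]] : p < k \/ p = k \/ p = k.+1 \/ k.+1 < p by lia.
  1-4: decide_tests; try exact: braid_eq_refl; exact: braid_eq_cancel.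
- have [pk|[pk|[pk|[pk|pk]]]] :
    p < k \/ p = k \/ p = k.+1 \/ p = k.+2 \/ k.+2 < p by lia.
  1-5: decide_tests; try exact: braid_eq_refl.
  have -> : k = k.-1.+1 by lia.
  exact: braid_eq_braid.
  exact: braid_eq_braid.
- have [pk|[pk|[pk|[pk|[pk|[pk|pk]]]]]] : p < k \/ p = k \/ p = k.+1 \/
      k.+1 < p < l \/ p = l \/ p = l.+1 \/ l.+1 < p by lia.
  1-7: decide_tests; try exact: braid_eq_refl; apply: braid_eq_comm; lia.
Qed.

End Strands.

(** * Parabolic subgroups of the braid group *)

Section Parabolics.
Local Open Scope group_scope.

Lemma generated_subgroup_group (G : groupType) (S : set G) :
  subgroup_set (generated_subgroup S).
Proof.
split=> [K [[]]//|x y xS yS K KS|x xS K KS].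
  by have [[_ KM _] _] := KS; apply: KM; [exact: xS|exact: yS].
by have [[_ _ KV] _] := KS; apply: KV; exact: xS.
Qed.

Lemma sub_generated_subgroup (G : groupType) (S : set G) :
  S `<=` generated_subgroup S.
Proof. exact: sub_smallest. Qed.

Lemma generated_subgroup_min (G : groupType) (S K : set G) :
  subgroup_set K -> S `<=` K -> generated_subgroup S `<=` K.
Proof. exact: smallest_sub. Qed.

Lemma generated_subgroup_mono (G : groupType) (S T : set G) :
  S `<=` T -> generated_subgroup S `<=` generated_subgroup T.
Proof.
move=> ST; apply: generated_subgroup_min; first exact: generated_subgroup_group.
by apply: subset_trans ST _; exact: sub_generated_subgroup.
Qed.

Lemma generated_subgroup_commute (G : groupType) (S T : set G) :
  (forall s t, S s -> T t -> s * t = t * s) ->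
  forall x y, generated_subgroup S x -> generated_subgroup T y ->
    x * y = y * x.
Proof.
have centralizer (A : set G) : subgroup_set [set x | forall a, A a -> x * a = a
  * x].
  split=> [a _|x y xA yA a Aa|x xA a Aa] /=; first by rewrite mul1g mulg1.
    by rewrite -mulgA yA// !mulgA xA.
  by apply: (mulgI x); rewrite !mulgA mulgV mul1g xA// mulgK.
move=> ST x y xS yT.
have yS : forall s, S s -> y * s = s * y.
  move=> s Ss; apply: (generated_subgroup_min (centralizer S)) yT s Ss.
  by move=> t Tt s Ss /=; rewrite -ST.
suff /(_ x xS y erefl) :
    generated_subgroup S `<=` [set z | forall a, [set y] a -> z * a = a * z] by
      [].
apply: generated_subgroup_min (centralizer [set y]) _ => s Ss _ /= ->.
by rewrite yS.
Qed.

Lemma braid_class_cat u v : braid_class (u ++ v)%SEQ = braid_class u *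
  braid_class v.
Proof. exact: esym (braid_mulE u v). Qed.

Lemma braid_classV u : braid_class (inv_word u) = (braid_class u)^-1.
Proof. exact: esym (braid_invE u). Qed.

Definition word_over (I : set nat) (u : braid_word) : Prop :=
  forall x, x \in u -> I x.1.

Lemma word_over_cons I x u : word_over I (x :: u) -> I x.1 /\ word_over I u.
Proof.
move=> Iu; split=> [|y yu]; first by apply: Iu; rewrite mem_head.
by apply: Iu; rewrite inE yu orbT.
Qed.

Lemma word_over_cat I u v :
  word_over I u -> word_over I v -> word_over I (u ++ v)%SEQ.
Proof. by move=> Iu Iv x; rewrite mem_cat => /orP[/Iu|/Iv]. Qed.

Definition parabolic (I : set nat) : set braid :=
  generated_subgroup (sigma @` I).

Lemma parabolicP I x :
  parabolic I x <-> exists2 u, word_over I u & x = braid_class u.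
Proof.
have IG := generated_subgroup_group (sigma @` I).
split=> [Ix|[u Iu ->]].
  pose W : set braid := [set x | exists2 u, word_over I u & x = braid_class u].
  suff /(_ x Ix) : generated_subgroup (sigma @` I) `<=` W by [].
  apply: generated_subgroup_min => [|_ [k Ik <-]]; last first.
    by exists [:: (k, false)] => // y; rewrite inE => /eqP ->.
  split=> [|_ _ [u Iu ->] [v Iv ->]|_ [u Iu ->]];
    first by exists [::] => // y; rewrite in_nil.
    by exists (u ++ v)%SEQ; rewrite ?braid_class_cat//; exact: word_over_cat.
  exists (inv_word u); rewrite ?braid_classV// => y.
  by rewrite mem_rev => /mapP[z zu ->]; exact: (Iu z).
have [I1 IM IV] := IG.
elim: u Iu => [_|[k e] u IH /word_over_cons[/= Ik Iu]]; first exact: I1.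
rewrite -cat1s braid_class_cat; apply: IM; last exact: IH.
have Isk : parabolic I (sigma k) by apply: sub_generated_subgroup; exists k.
by case: e => //; have := IV _ Isk; rewrite -braid_classV.
Qed.

Lemma parabolic_top : parabolic setT = [set: braid].
Proof.
apply/seteqP; split=> // x _; apply/parabolicP; exists (repr x) => //.
by rewrite braid_classK.
Qed.

Lemma parabolic0 x : parabolic set0 x -> x = 1.
Proof.
move=> /parabolicP[[|y u] Iu ->//].
by have [] := word_over_cons Iu.
Qed.

Lemma sh_parabolic I : sh @` parabolic I = parabolic (S @` I).
Proof.
apply/seteqP; split=> [_ [_ /parabolicP[u Iu ->] <-]|x /parabolicP[u]].
  apply/parabolicP; exists (shift_word u); last exact: shE.
  by move=> y /mapP[z zu ->]; exists z.1 => //; exact: Iu.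
elim: u x => [x _ ->|[k e] u IH x /word_over_cons[[j Ij /= jk] Iu] ->].
  by exists 1; [have [] := generated_subgroup_group (sigma @` I)|exact: shE].
have [y Iy yu] := IH _ Iu erefl; have [v Iv yE] := (parabolicP I y).1 Iy.
exists (braid_class ((j, e) :: v)).
  apply/parabolicP; exists ((j, e) :: v) => // z.
  by rewrite inE => /predU1P[->//|/Iv].
rewrite shE -cat1s -(cat1s _ u) /shift_word map_cat !braid_class_cat -yu yE shE.
by rewrite -jk.
Qed.

(** By the hypothesis on [p] the strand starts in the block of positions that
    can be reached from position 0 by generators in [I], and it never leaves
    this block.  A letter that survives lies either to the right of the strand
    and is lowered by one, or to the left of it, and then its successor is the
    index of a generator in [I] by the same hypothesis. *)
Lemma delete_strand_over I p u :
  (forall j, (j < p)%N -> I j) -> word_over I u ->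
  word_over [set k | I k.+1] (delete_strand p u) /\
  (forall j, (j < strand_end p u)%N -> I j).
Proof.
elim: u p => [//|[k e] u IH] p Ip /word_over_cons[/= Ik Iu] /=.
have Ic j : (j < cross k p)%N -> I j.
  rewrite /cross; have [pk|_] := eqVneq p k.
    by rewrite ltnS leq_eqVlt -pk => /predU1P[->|/Ip//]; rewrite pk.
  have [pk|_] := eqVneq p k.+1; last exact: Ip.
  by move=> jk; apply: Ip; lia.
have [Id Ie] := IH (cross k p) Ic Iu; split=> //.
apply: word_over_cat => // x; rewrite /delete_letter /=.
case: ltnP => [pk|_].
  by rewrite inE => /eqP -> /=; rewrite prednK//; lia.
case: ltnP => // pk; rewrite inE => /eqP -> /=; exact: Ip.
Qed.

Lemma delete_strand_fix p u : word_over [set k | (k.+1 < p)%N] u ->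
  delete_strand p u = u /\ strand_end p u = p.
Proof.
elim: u p => [//|[k e] u IH] p /word_over_cons[/= kp Iu].
have -> : cross k p = p by rewrite /cross; repeat case: eqP => //; lia.
have [-> ->] := IH p Iu; split=> //; rewrite /delete_letter /=.
by rewrite kp ltnNge (ltnW (ltnW kp)).
Qed.

Lemma delete_strand_shift u :
  delete_strand 0 (shift_word u) = u /\ strand_end 0 (shift_word u) = 0%N.
Proof. by elim: u => //= -[k e] u [-> ->]. Qed.

(** Deleting the first strand undoes the shift, so [x] is the shift of the braid
    that results from deleting the first strand of a word over [I]. *)
Lemma parabolic_range_sh I x :
  parabolic I x -> range sh x -> parabolic (I `\ 0%N) x.
Proof.
move=> /parabolicP[u Iu ->] [y _]; rewrite -[y]braid_classK shE.
set v := repr y => vu;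
  have /delete_strand_eq/(_ 0%N) := (braid_classP _ _).2 vu.
rewrite (delete_strand_shift v).1 => /braid_classP vE.
rewrite -vu -shE vE shE; apply/parabolicP.
exists (shift_word (delete_strand 0 u)) => // _ /mapP[z zu ->].
have [Id _] : word_over [set k | I k.+1] (delete_strand 0 u) /\
    (forall j, (j < strand_end 0 u)%N -> I j) by apply: delete_strand_over.
by split=> //; exact: Id zu.
Qed.

Lemma parabolic_sub I J : I `<=` J -> parabolic I `<=` parabolic J.
Proof. by move=> IJ; apply: generated_subgroup_mono; exact: image_subset. Qed.

Lemma range_sh_parabolic : range sh = parabolic (range S).
Proof.
by rewrite -sh_parabolic parabolic_top.
Qed.

Lemma sh_inj : injective sh.
Proof.
move=> x y; rewrite -[x]braid_classK -[y]braid_classK !shE.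
move=> /(braid_classP _ _).2 /delete_strand_eq/(_ 0%N).
by rewrite !(delete_strand_shift _).1 => /braid_classP.
Qed.

Lemma parabolic_bounded I x :
  parabolic I x -> exists n, parabolic (I `&` [set k | (k < n)%N]) x.
Proof.
move=> /parabolicP[u Iu ->]; exists (\max_(y <- u) y.1.+1)%N.
apply/parabolicP; exists u => // y yu; split; first exact: Iu.
by rewrite /= (big_rem y)//= leq_max ltnSn.
Qed.

(** Remove the generator of index 0 from whichever set contains it, shift down
    and induct on the number of generators used. *)
Lemma parabolic_disjoint I J x : I `&` J = set0 ->
  parabolic I x -> parabolic J x -> x = 1.
Proof.
move=> IJ0 Ix /parabolic_bounded[n]; move: IJ0 Ix.
elim: n I J x => [|n IH] I J x IJ0 Ix Jx.
  by apply: parabolic0; apply: parabolic_sub Jx => k [].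
have notin0 (I' J' : set nat) : ~ I' 0%N -> parabolic I' x -> parabolic J' x ->
    parabolic (J' `\ 0%N) x.
  move=> I'0 I'x J'x; apply: parabolic_range_sh => //.
  rewrite range_sh_parabolic; apply: parabolic_sub I'x => -[//|k _].
  by exists k.
have [I0 J0] : parabolic (I `\ 0%N) x /\
    parabolic ((J `&` [set k | (k < n.+1)%N]) `\ 0%N) x.
  have [I0|I0] := pselect (I 0%N); last first.
    have J0 := notin0 _ _ I0 Ix Jx; split=> //.
    by apply: notin0 J0 Ix => -[_]; apply.
  have J0 : ~ (J `&` [set k | (k < n.+1)%N]) 0%N.
    by move=> [J0 _]; have : (I `&` J) 0%N by []; rewrite IJ0.
  have I1 := notin0 _ _ J0 Jx Ix; split=> //.
  by apply: notin0 I1 Jx => -[_]; apply.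
have shift (K : set nat) : K `\ 0%N = S @` [set k | K k.+1].
  by apply/seteqP; split=> [[|k] [Kk k0]|_ [k Kk <-]];
    [by case: k0|by exists k|by split].
move: I0 J0; rewrite !shift -!sh_parabolic => -[y Iy <-] [z Jz /sh_inj zy].
rewrite {}zy in Jz.
suff -> : y = 1 by rewrite shE.
apply: (IH [set k | I k.+1] [set k | J k.+1]) => //.
  by apply/seteqP; split=> // k [/= Ik Jk]; have : (I `&` J) k.+1 by [];
    rewrite IJ0.
Qed.

Lemma sigma_commute_far i j : (i.+1 < j)%N -> sigma i * sigma j = sigma j *
  sigma i.
Proof.
by move=> ij; rewrite -!braid_class_cat; apply/braid_classP/braid_eq_comm.
Qed.

Lemma sigma_braid i :
  sigma i * sigma i.+1 * sigma i = sigma i.+1 * sigma i * sigma i.+1.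
Proof.
by rewrite /sigma -!braid_class_cat; apply/braid_classP; exact: braid_eq_braid.
Qed.

Lemma parabolic_commute I J x y : (forall i j, I i -> J j -> (i.+1 < j)%N) ->
  parabolic I x -> parabolic J y -> x * y = y * x.
Proof.
move=> IJ; apply: generated_subgroup_commute => _ _ [i Ii <-] [j Jj <-].
exact/sigma_commute_far/IJ.
Qed.

Lemma parabolic_sigma I k : I k -> parabolic I (sigma k).
Proof. by move=> Ik; apply: sub_generated_subgroup; exists k. Qed.

(** Follow the strand in the last of the [n.+2] positions through
    [sigma n * x * (sigma n)^-1].  It enters [x] at position [n] and must also
    leave it there, for otherwise the conjugate would move the last strand.
    Deleting it removes both outer crossings and leaves a braid in
    [braid_sub n] on the one hand, and the conjugate itself on the other. *)
Lemma sigma_conj_drop n x : braid_sub n.+1 x ->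
  braid_sub n.+1 (sigma n * x * (sigma n)^-1) -> braid_sub n x.
Proof.
move=> xB; have [u uB xu] := (parabolicP _ _).1 xB.
move=> /parabolicP[v vB]; rewrite {1}xu.
have conjE : sigma n * braid_class u * (sigma n)^-1 =
    braid_class ([:: (n, false)] ++ u ++ [:: (n, true)])%SEQ.
  by rewrite !braid_class_cat mulgA -[braid_class [:: (n, true)]]/(braid_class
    (inv_word [:: (n, false)])) braid_classV.
rewrite conjE => uv; have uv' := (braid_classP _ _).2 uv.
have [dv ev] := @delete_strand_fix n.+1 v vB.
have crossn : cross n n.+1 = n by rewrite /cross; case: eqP; [lia|rewrite eqxx].
have [ud ue] : word_over [set k | (k.+1 < n)%N] (delete_strand n u) /\
    (forall j, (j < strand_end n u)%N -> (j < n)%N).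
  by apply: (@delete_strand_over [set k | (k < n)%N] n u).
have en : strand_end n u = n.
  have := strand_end_eq uv' n.+1; rewrite ev /= crossn strand_end_cat /=.
  have : (strand_end n u <= n)%N.
    by rewrite leqNgt; apply/negP => /ue; rewrite ltnn.
  by rewrite /cross; repeat case: eqP => //; lia.
have := delete_strand_eq uv' n.+1; rewrite dv /= crossn delete_strand_cat en /=.
have -> e : delete_letter n.+1 (n, e) = [::] by rewrite /delete_letter /= ltnn
  ltnNge leqnSn.
have -> e : delete_letter n (n, e) = [::] by rewrite /delete_letter /= ltnn
  ltnNge leqnSn.
rewrite cat0s => /braid_classP uv2.
have vn : braid_sub n (braid_class v).
  by rewrite -uv2 (cats0 (delete_strand n u)); apply/parabolicP;
    exists (delete_strand n u).
suff -> : x = braid_class v by [].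
apply: (mulgI (sigma n)); apply: (mulIg (sigma n)^-1); rewrite xu conjE uv.
have <- : braid_class v * sigma n = sigma n * braid_class v.
  apply: parabolic_commute vn (@parabolic_sigma [set n] n erefl).
  by move=> i _ /= ? ->.
by rewrite mulgK.
Qed.

Lemma braid_sub_exists x : exists n, braid_sub n x.
Proof.
have : parabolic setT x by rewrite parabolic_top.
move=> /parabolic_bounded[n xn]; exists n.+1.
by apply: parabolic_sub xn => k [_].
Qed.

Lemma braid_sub_leq m n : (m <= n)%N -> braid_sub m `<=` braid_sub n.
Proof. by move=> mn; apply: parabolic_sub => k /= km; exact: leq_trans mn. Qed.

Definition ascending (n : nat) : braid := \big[*%g/1%g]_(k < n) sigma k.

Lemma ascendingS n : ascending n.+1 = ascending n * sigma n.
Proof. exact: big_ord_recr. Qed.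

Lemma ascending_parabolic n : parabolic [set k | (k < n)%N] (ascending n).
Proof.
have [I1 IM _] := generated_subgroup_group (sigma @` [set k | (k < n)%N]).
by rewrite /ascending; elim/big_ind: _ => // i _; apply: parabolic_sigma;
  exact: ltn_ord.
Qed.

Lemma ascending_sigma n k : (k.+1 < n)%N ->
  ascending n * sigma k = sigma k.+1 * ascending n.
Proof.
elim: n => // n IH; rewrite ltnS leq_eqVlt => /predU1P[<-|kn].
  have ak : ascending k * sigma k.+1 = sigma k.+1 * ascending k.
    apply: (@parabolic_commute [set j | (j < k)%N] [set k.+1]).
    - by move=> i j /= ik ->.
    - exact: ascending_parabolic.
    - exact: parabolic_sigma.
  rewrite !ascendingS -2!mulgA (mulgA (sigma k)) sigma_braid.
  by rewrite !mulgA ak.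
by rewrite ascendingS -mulgA -sigma_commute_far// mulgA IH// -mulgA.
Qed.

(** Conjugation by an ascending product is the shift on all generators that are
    far enough to the left of its end. *)
Lemma ascending_conj n x : braid_sub n x ->
  ascending n * x * (ascending n)^-1 = sh x.
Proof.
move=> xn; suff : ascending n * x = sh x * ascending n by move=> ->;
  rewrite mulgK.
pose W := [set x | ascending n * x = sh x * ascending n].
suff /(_ x xn) : braid_sub n `<=` W by [].
apply: generated_subgroup_min => [|_ [k kn <-]]; last first.
  by rewrite /W /= sh_sigma ascending_sigma.
split=> [|y z yW zW|y yW]; rewrite /W /=.
- by rewrite gmulf1 mulg1 mul1g.
- by rewrite gmulfM mulgA yW -!mulgA zW.
- by rewrite gmulfV; apply: (mulgI (sh y));
  rewrite !mulgA mulgV mul1g -yW mulgK.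
Qed.

End Parabolics.

Local Open Scope ring_scope.
Local Open Scope complex_scope.

(** * Squared moduli of complex numbers *)

Section ModulusSquared.
Variable R : realType.
Local Notation C := R[i].
Implicit Types z w : C.

Definition modsq z : R := Normc.normc z ^+ 2.

Lemma modsqE z : modsq z = complex.Re z ^+ 2 + complex.Im z ^+ 2.
Proof. by case: z => a b; rewrite /modsq /= sqr_sqrtr// addr_ge0// sqr_ge0. Qed.

Lemma modsq_ge0 z : 0 <= modsq z. Proof. exact: sqr_ge0. Qed.

Lemma mulCJ z : z * z^*%C = (modsq z)%:C.
Proof.
case: z => a b; rewrite modsqE /=; apply/eqP; rewrite eq_complex /=.
by apply/andP; split; apply/eqP; ring.
Qed.

Lemma normc_ge0 z : 0 <= Normc.normc z.
Proof. by case: z => a b; exact: sqrtr_ge0. Qed.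

Lemma normcJE z : Normc.normc z^*%C = Normc.normc z.
Proof. by case: z => a b /=; rewrite sqrrN. Qed.

Lemma normc_real (r : R) : Normc.normc r%:C = `|r|.
Proof. by rewrite /= expr0n addr0 sqrtr_sqr. Qed.

Lemma normc_Re z : `|complex.Re z| <= Normc.normc z.
Proof.
by case: z => a b /=; rewrite -sqrtr_sqr ler_wsqrtr// lerDl sqr_ge0.
Qed.

Lemma normc_Im z : `|complex.Im z| <= Normc.normc z.
Proof.
by case: z => a b /=; rewrite -sqrtr_sqr ler_wsqrtr// lerDr sqr_ge0.
Qed.

Lemma normc_le_ReIm z : Normc.normc z <= `|complex.Re z| + `|complex.Im z|.
Proof.
rewrite -(ler_pXn2r (_ : (0 < 2)%N)) ?nnegrE ?normc_ge0 ?addr_ge0//.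
rewrite -/(modsq z) modsqE sqrrD !real_normK ?num_real//.
by rewrite lerD2r lerDl mulrn_wge0// mulr_ge0.
Qed.

End ModulusSquared.

(** * Unordered sums of real families *)

Section UnorderedSums.
Variables (R : realType) (T : choiceType).
Implicit Types f g : T -> R.

Definition nsum f : \bar R := (\esum_(x in [set: T]) (f x)%:E)%E.

Definition summing f : Prop := (nsum f < +oo)%E.

Lemma nsum_ge0 f : (forall x, 0 <= f x) -> (0 <= nsum f)%E.
Proof. by move=> f0; apply: esum_ge0 => x _; rewrite lee_fin. Qed.

Lemma nsum_fineK f : (forall x, 0 <= f x) -> summing f ->
  (fine (nsum f))%:E = nsum f.
Proof.
by move=> f0 foo; rewrite fineK// ge0_fin_numE//; exact: nsum_ge0.
Qed.

Lemma le_nsum f g : (forall x, f x <= g x) -> (nsum f <= nsum g)%E.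
Proof. by move=> fg; apply: le_esum => x _; rewrite lee_fin. Qed.

Lemma nsumD f g : (forall x, 0 <= f x) -> (forall x, 0 <= g x) ->
  nsum (fun x => f x + g x) = (nsum f + nsum g)%E.
Proof.
by move=> f0 g0; rewrite /nsum -esumD => [|x _|x _]; rewrite ?lee_fin.
Qed.

Lemma nsum1 f t : 0 <= f t -> (forall x, x <> t -> f x = 0) ->
  nsum f = (f t)%:E.
Proof.
move=> ft0 f0; rewrite -(@esum_set1 R T t (fun x => (f x)%:E)) ?lee_fin//.
rewrite /nsum [RHS]esum_mkcond; apply: eq_esum => x _.
have [xt|xt] := pselect (x = t); first by rewrite xt mem_set.
by rewrite memNset// f0.
Qed.

Lemma nsumZ c f : 0 <= c -> (forall x, 0 <= f x) ->
  nsum (fun x => c * f x) = (c%:E * nsum f)%E.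
Proof.
move=> c0 f0; have le k g : 0 <= k -> (forall x, 0 <= g x) ->
    (nsum (fun x => k * g x)%R <= k%:E * nsum g)%E.
  move=> k0 g0; apply: ge_ereal_sup => _ [A [finA _] <-].
  rewrite (eq_fsbigr (fun x => k%:E * (g x)%:E)%E); last by move=> x _;
    rewrite EFinM.
  rewrite -ge0_mule_fsumr => [|x]; last by rewrite lee_fin.
  apply: lee_wpmul2l; rewrite ?lee_fin//.
  by apply: esum_ge; exists A.
apply/eqP; rewrite eq_le le//=.
have [->|cn0] := eqVneq c 0.
  rewrite mul0e; apply: nsum_ge0 => x; by rewrite mul0r.
have cp : 0 < c by rewrite lt_neqAle eq_sym cn0.
have := le c^-1 (fun x => c * f x).
rewrite invr_ge0 => /(_ c0 (fun x => mulr_ge0 c0 (f0 x))).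
under eq_fun do rewrite mulrA mulVf// mul1r.
move=> /(lee_wpmul2l (_ : (0 <= c%:E)%E)).
rewrite lee_fin => /(_ c0) /le_trans; apply.
by rewrite muleA -EFinM mulfV// mul1e.
Qed.

Lemma nsum_fiber f (p : T -> T) : (forall x, 0 <= f x) ->
  nsum f = (\esum_(r in [set: T])
    nsum (fun t => if p t == r then f t else 0%R))%E.
Proof.
move=> f0.
transitivity (\esum_(r in [set: T]) \esum_(t in [set t | p t = r]) (f t)%:E)%E.
  rewrite esum_esum => [|i j _ _]; last by rewrite lee_fin.
  rewrite [RHS](reindex_esum [set: T] _ (fun t => (p t, t)))//.
  split=> // [x y _ _ []//|[r t] [_ /= <-]]; by exists t.
apply: eq_esum => r _; rewrite esum_mkcond; apply: eq_esum => t _.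
have [<-|/eqP tr] := eqVneq (p t) r; first by rewrite mem_set.
by rewrite memNset.
Qed.

Lemma nsum_bij f (e : T -> T) : bijective e -> nsum (f \o e) = nsum f.
Proof.
move=> be; rewrite /nsum [RHS](reindex_esum [set: T] _ e)//.
by rewrite setTT_bijective.
Qed.

Lemma nsum_ge_seq f (s : seq T) : uniq s ->
  ((\sum_(x <- s) f x)%:E <= nsum f)%E.
Proof.
move=> us; apply: esum_ge; exists [set` s]; first by split=> //;
  exact: finite_seq.
by rewrite -fsbig_seq// sumEFin.
Qed.

Lemma nsum_le_seq f (M : \bar R) :
  (forall s, uniq s -> ((\sum_(x <- s) f x)%:E <= M)%E) -> (nsum f <= M)%E.
Proof.
move=> fM; apply: ge_ereal_sup => _ [A [finA _] <-].
have [s ->] := (finite_seqP A).1 finA.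
have -> : [set` s] = [set` undup s] by apply/seteqP; split=> x /=;
  rewrite mem_undup.
by rewrite -fsbig_seq ?undup_uniq// sumEFin; exact: fM (undup_uniq s).
Qed.

Lemma nsum_approx f e : (forall x, 0 <= f x) -> summing f -> 0 < e ->
  exists2 s, uniq s & (nsum f < (\sum_(x <- s) f x + e)%:E)%E.
Proof.
move=> f0 fs e0; have ffin : nsum f \is a fin_num.
  by rewrite ge0_fin_numE//; exact: nsum_ge0.
have [_ [A [finA _] <-] lt] := ub_ereal_sup_adherent e0 ffin.
move: lt; have [s ->] := (finite_seqP A).1 finA.
have -> : [set` s] = [set` undup s] by apply/seteqP; split=> x /=;
  rewrite mem_undup.
rewrite -fsbig_seq ?undup_uniq// sumEFin lteBlDr// => lt.
by exists (undup s); rewrite ?undup_uniq// EFinD.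
Qed.

(** Every decomposition into summable nonnegative parts computes the sum, in
    particular one that is additive in [f]; linearity of the sum follows. *)
Lemma rsum_sub f g h : (forall x, f x = g x - h x) ->
  (forall x, 0 <= g x) -> (forall x, 0 <= h x) ->
  summing g -> summing h ->
  rsum f = fine (nsum g) - fine (nsum h).
Proof.
move=> fE g0 h0 goo hoo.
pose fp x := Num.max (f x) 0; pose fn x := Num.max (- f x) 0.
rewrite /rsum -/(nsum fp) -/(nsum fn).
have fp0 x : 0 <= fp x by rewrite le_max lexx orbT.
have fn0 x : 0 <= fn x by rewrite le_max lexx orbT.
have fpoo : summing fp.
  apply: le_lt_trans goo; apply: le_nsum => x.
  by rewrite ge_max g0 fE gerBl h0.
have fnoo : summing fn.
  apply: le_lt_trans hoo; apply: le_nsum => x.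
  by rewrite ge_max h0 fE opprB gerBl g0.
have : (nsum fp + nsum h = nsum fn + nsum g)%E.
  rewrite -!nsumD//; congr nsum; apply/funext => x.
  have := fE x; rewrite /fp /fn; case: (leP (f x) 0); case: (leP (- f x) 0);
    lra.
rewrite -(nsum_fineK fp0)// -(nsum_fineK fn0)// -(nsum_fineK g0)//.
by rewrite -(nsum_fineK h0)// -!EFinD => -[]; lra.
Qed.

Definition abs_summable f : Prop := summing (fun x => `|f x|).

Lemma abs_summable_parts f : abs_summable f ->
  summing (fun x => Num.max (f x) 0) /\
  summing (fun x => Num.max (- f x) 0).
Proof.
by move=> fs; split; apply: le_lt_trans fs; apply: le_nsum => x;
  rewrite ge_max normr_ge0 ?ler_norm// -normrN ler_norm.
Qed.

Lemma abs_summableD f g :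
  abs_summable f -> abs_summable g -> abs_summable (fun x => f x + g x).
Proof.
move=> fs gs; apply: (@le_lt_trans _ _ (nsum (fun x => `|f x| + `|g x|))).
  by apply: le_nsum => x; exact: ler_normD.
by rewrite /summing nsumD// lte_add_pinfty.
Qed.

Lemma abs_summableZ c f : abs_summable f -> abs_summable (fun x => c * f x).
Proof.
rewrite /abs_summable /summing => fs; under eq_fun do rewrite normrM.
rewrite nsumZ// -(nsum_fineK _ fs) -?EFinM ?ltry//.
Qed.

Lemma rsumD f g : abs_summable f -> abs_summable g ->
  rsum (fun x => f x + g x) = rsum f + rsum g.
Proof.
move=> /abs_summable_parts[fp fn] /abs_summable_parts[gp gn].
have max0 (x : R) : 0 <= Num.max x 0 by rewrite le_max lexx orbT.
rewrite (@rsum_sub _ (fun x => Num.max (f x) 0 + Num.max (g x) 0)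
   (fun x => Num.max (- f x) 0 + Num.max (- g x) 0)).
- rewrite !nsumD// /rsum -!/(nsum _) !fineD ?ge0_fin_numE ?nsum_ge0//.
  lra.
- move=> x; case: (leP (f x) 0); case: (leP (- f x) 0);
    case: (leP (g x) 0); case: (leP (- g x) 0); lra.
- by move=> x; rewrite addr_ge0.
- by move=> x; rewrite addr_ge0.
- by rewrite /summing nsumD// lte_add_pinfty.
- by rewrite /summing nsumD// lte_add_pinfty.
Qed.

Lemma rsumN f : rsum (fun x => - f x) = - rsum f.
Proof.
rewrite /rsum opprB; congr (_ - fine _).
by apply: eq_esum => x _; rewrite opprK.
Qed.

Lemma rsum_nneg f : (forall x, 0 <= f x) -> rsum f = fine (nsum f).
Proof.
move=> f0; rewrite /rsum (_ : (fun x => _) = (fun x => (f x)%:E)); last first.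
  by apply/funext => x; rewrite max_l.
rewrite [X in _ - fine X]esum1 ?subr0// => x _.
by rewrite max_r// oppr_le0.
Qed.

Lemma rsumZ c f : abs_summable f -> rsum (fun x => c * f x) = c * rsum f.
Proof.
wlog c0 : c / 0 <= c => [H fs|/abs_summable_parts[fp fn]].
  have [c0|/ltW c0] := leP 0 c; first exact: H.
  rewrite -[c]opprK mulNr -H ?oppr_ge0// -rsumN.
  by congr rsum; apply/funext => x; rewrite mulNr.
have max0 (x : R) : 0 <= Num.max x 0 by rewrite le_max lexx orbT.
have fin g : (forall x, 0 <= g x) -> summing g ->
    (c%:E * nsum g)%E = (c * fine (nsum g))%:E.
  by move=> g0 gs; rewrite EFinM nsum_fineK.
rewrite (@rsum_sub _ (fun x => c * Num.max (f x) 0)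
   (fun x => c * Num.max (- f x) 0)).
- by rewrite !nsumZ// !fin//= mulrBr.
- move=> x; rewrite -mulrBr; congr (_ * _).
  case: (leP (f x) 0); case: (leP (- f x) 0); lra.
- by move=> x; rewrite mulr_ge0.
- by move=> x; rewrite mulr_ge0.
- by rewrite /summing nsumZ// fin// ltry.
- by rewrite /summing nsumZ// fin// ltry.
Qed.

Lemma rsum_combination a b f g h :
  abs_summable f -> abs_summable g -> abs_summable h ->
  rsum (fun x => a * f x + b * g x + h x) = a * rsum f + b * rsum g + rsum h.
Proof.
move=> fs gs hs.
rewrite (rsumD (abs_summableD (abs_summableZ a fs) (abs_summableZ b gs)) hs).
by rewrite (rsumD (abs_summableZ a fs) (abs_summableZ b gs)) !rsumZ.
Qed.

Lemma rsum1 f t : (forall x, x <> t -> f x = 0) -> rsum f = f t.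
Proof.
move=> f0; rewrite /rsum -/(nsum (fun x => Num.max (f x) 0)).
rewrite -/(nsum (fun x => Num.max (- f x) 0)) !(@nsum1 _ t) /=.
- case: (leP (f t) 0); case: (leP (- f t) 0); lra.
- by rewrite le_max lexx orbT.
- by move=> x /f0 ->; rewrite oppr0 maxxx.
- by rewrite le_max lexx orbT.
- by move=> x /f0 ->; rewrite maxxx.
Qed.

Lemma rsum_bij f (e : T -> T) : bijective e -> rsum (f \o e) = rsum f.
Proof.
move=> be; rewrite /rsum.
by rewrite -!/(nsum _) -(nsum_bij (fun x => Num.max (f x) 0) be)
  -(nsum_bij (fun x => Num.max (- f x) 0) be).
Qed.

End UnorderedSums.

(** * The Hilbert space of square summable functions *)

Section SquareSummable.
Variables (R : realType) (G : groupType).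
Local Notation C := R[i].
Local Notation H := (l2 R G).
Implicit Types (u v w : H) (a c : C) (s t : G).

Lemma l2_ext u v : (forall t, u t = v t) -> u = v.
Proof. by move=> uv; apply: val_inj; apply/funext. Qed.

Lemma l2D u v t : (u + v) t = u t + v t. Proof. by []. Qed.
Lemma l2Z a u t : (a *: u) t = a * u t. Proof. by []. Qed.
Lemma l2B u v t : (u - v) t = u t - v t. Proof. by []. Qed.
Lemma l20 t : (0 : H) t = 0. Proof. by []. Qed.
Lemma l2_sum (I : Type) (r : seq I) (F : I -> H) t :
  (\sum_(i <- r) F i) t = \sum_(i <- r) F i t.
Proof. by elim/big_rec2: _ => // i x y _ <-. Qed.

Lemma l2_summing u : summing (fun x => modsq (u x)).
Proof. by have /asboolP := l2_funP u. Qed.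

Lemma sqsummableP (f : G -> C) :
  summing (fun x => modsq (f x)) -> f \in @sqsummable_pred R G.
Proof. by move=> fs; apply/asboolP. Qed.

Lemma norm2_ge0 u : 0 <= norm2 u. Proof. exact: sqrtr_ge0. Qed.

Lemma norm2_sq u : (norm2 u ^+ 2)%:E = nsum (fun x => modsq (u x)).
Proof.
have u0 x : 0 <= modsq (u x) by exact: modsq_ge0.
rewrite /norm2 sqr_sqrtr ?nsum_fineK//; first exact: l2_summing.
by apply: fine_ge0; exact: nsum_ge0.
Qed.

Lemma norm2_sqr u : norm2 u ^+ 2 = fine (nsum (fun x => modsq (u x))).
Proof. by rewrite -norm2_sq. Qed.

Lemma inner_summable u v :
  abs_summable (fun x => complex.Re (u x * (v x)^*%C)) /\
  abs_summable (fun x => complex.Im (u x * (v x)^*%C)).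
Proof.
have uv : summing (fun x => modsq (u x) + modsq (v x)).
  rewrite /summing nsumD => [|x|x]; rewrite ?modsq_ge0//.
  by apply: lte_add_pinfty; exact: l2_summing.
have le x : Normc.normc (u x * (v x)^*%C) <= modsq (u x) + modsq (v x).
  rewrite Normc.normcM normcJE /modsq.
  have := normc_ge0 (u x); have := normc_ge0 (v x).
  set p := Normc.normc _; set q := Normc.normc _ => p0 q0.
  have : 0 <= (p - q) ^+ 2 by exact: sqr_ge0.
  by have := mulr_ge0 q0 p0; nra.
by split; apply: le_lt_trans uv; apply: le_nsum => x; apply: le_trans (le x);
  [exact: normc_Re|exact: normc_Im].
Qed.

Lemma inner_linear a u v w : inner (a *: u + v) w = a * inner u w + inner v w.
Proof.
have [uR uI] := inner_summable u w; have [vR vI] := inner_summable v w.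
rewrite /inner /csum.
have ReM (x y : C) : complex.Re (x * y) =
    complex.Re x * complex.Re y + (- complex.Im x) * complex.Im y.
  by case: x => p q; case: y => r s /=; rewrite mulNr.
have ImM (x y : C) : complex.Im (x * y) =
    complex.Re x * complex.Im y + complex.Im x * complex.Re y.
  by case: x => p q; case: y => r s /=.
rewrite (_ : (fun x => complex.Re ((a *: u + v) x * (w x)^*%C)) =
  (fun x => (complex.Re a * complex.Re (u x * (w x)^*%C) +
    (- complex.Im a) * complex.Im (u x * (w x)^*%C)) +
    complex.Re (v x * (w x)^*%C))); last first.
  by apply/funext => x; rewrite -ReM mulrA -raddfD/= -mulrDl.
rewrite (_ : (fun x => complex.Im ((a *: u + v) x * (w x)^*%C)) =
  (fun x => (complex.Re a * complex.Im (u x * (w x)^*%C) +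
    complex.Im a * complex.Re (u x * (w x)^*%C)) +
    complex.Im (v x * (w x)^*%C))); last first.
  by apply/funext => x; rewrite -ImM mulrA -raddfD/= -mulrDl.
rewrite !rsum_combination//.
clear ReM ImM; case: a => p q; apply/eqP; rewrite eq_complex /=.
by apply/andP; split; apply/eqP; ring.
Qed.

Lemma innerC u v : inner v u = (inner u v)^*%C.
Proof.
rewrite /inner /csum /=; congr (_ +i* _); last rewrite -rsumN;
  congr rsum; apply/funext => x; case: (u x) => p q; case: (v x) => r s /=;
    ring.
Qed.

Lemma innerDl u v w : inner (u + v) w = inner u w + inner v w.
Proof. by rewrite -[u]scale1r inner_linear mul1r scale1r. Qed.

Lemma inner0l w : inner 0 w = 0.
Proof. by apply: (addrI (inner 0 w)); rewrite -innerDl !addr0. Qed.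

Lemma innerZl a u w : inner (a *: u) w = a * inner u w.
Proof. by rewrite -[a *: u]addr0 inner_linear inner0l addr0. Qed.

Lemma innerNl u w : inner (- u) w = - inner u w.
Proof. by rewrite -scaleN1r innerZl mulN1r. Qed.

Lemma innerBl u v w : inner (u - v) w = inner u w - inner v w.
Proof. by rewrite innerDl innerNl. Qed.

Lemma innerDr u v w : inner w (u + v) = inner w u + inner w v.
Proof.
by rewrite (innerC (u + v)) (innerC u) (innerC v) innerDl; exact: rmorphD.
Qed.

Lemma innerZr a u w : inner w (a *: u) = a^*%C * inner w u.
Proof. by rewrite (innerC (a *: u)) (innerC u) innerZl; exact: rmorphM. Qed.

Lemma inner0r w : inner w 0 = 0.
Proof. by rewrite innerC inner0l conjc0. Qed.

Lemma innerNr u w : inner w (- u) = - inner w u.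
Proof. by rewrite (innerC (- u)) (innerC u) innerNl; exact: rmorphN. Qed.

Lemma innerBr u v w : inner w (u - v) = inner w u - inner w v.
Proof. by rewrite innerDr innerNr. Qed.

Lemma inner_self u : inner u u = (norm2 u ^+ 2)%:C.
Proof.
rewrite /inner /csum norm2_sqr -rsum_nneg => [|x]; last exact: modsq_ge0.
apply/eqP; rewrite eq_complex /=; apply/andP; split; apply/eqP.
  by congr rsum; apply/funext => x; rewrite mulCJ.
rewrite -[RHS](@mul0r _ (rsum (fun x => modsq (u x)))) -rsumZ.
  by congr rsum; apply/funext => x; rewrite mulCJ mul0r.
rewrite /abs_summable (_ : (fun x => `|modsq (u x)|) = (fun x => modsq (u x))).
  exact: l2_summing.
by apply/funext => x; rewrite ger0_norm// modsq_ge0.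
Qed.

Lemma delta_eq s : (delta R s) s = 1.
Proof. by rewrite /= /delta_fun eqxx. Qed.

Lemma delta_neq s t : t <> s -> (delta R s) t = 0.
Proof. by move=> /eqP/negbTE; rewrite /= /delta_fun => ->. Qed.

Lemma inner_delta u t : inner u (delta R t) = u t.
Proof.
have z x : x <> t -> u x * ((delta R t) x)^*%C = 0.
  by move=> /delta_neq ->; rewrite conjc0 mulr0.
rewrite /inner /csum !(@rsum1 _ _ _ t) => [|x /z ->//|x /z ->//].
by rewrite delta_eq conjc1 mulr1; case: (u t).
Qed.

Lemma inner_deltal u t : inner (delta R t) u = (u t)^*%C.
Proof. by rewrite innerC inner_delta. Qed.

Lemma norm2_eq0 u : norm2 u = 0 -> u = 0.
Proof.
move=> u0; apply: l2_ext => t; apply: Normc.eq0_normc.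
have : (modsq (u t) <= norm2 u ^+ 2).
  rewrite -lee_fin norm2_sq; apply: esum_ge; exists [set t].
    by split=> //; exact: finite_set1.
  by rewrite fsbig_set1.
by rewrite u0 expr0n /= /modsq; move: (normc_ge0 (u t)); nra.
Qed.

(** The usual discriminant argument: expand the norm of
    [norm2 v ^+ 2 *: u - inner u v *: v]. *)
Lemma cauchy_schwarz u v : Normc.normc (inner u v) <= norm2 u * norm2 v.
Proof.
have [v0|vn0] := eqVneq (norm2 v) 0.
  by rewrite (norm2_eq0 v0) inner0r Normc.normc0 mulr_ge0// norm2_ge0.
set z := inner u v; set q := norm2 v ^+ 2.
have qp : 0 < q by rewrite exprn_gt0// lt_neqAle eq_sym vn0 norm2_ge0.
pose w := q%:C *: u - z *: v.
have : inner w w = (q * (q * norm2 u ^+ 2 - modsq z))%:C.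
  have -> : (q * (q * norm2 u ^+ 2 - modsq z))%:C =
      q%:C * (q%:C * (norm2 u ^+ 2)%:C - z * z^*%C).
    by rewrite mulCJ -rmorphM -rmorphB -rmorphM.
  rewrite /w innerBl !innerBr !innerZl !innerZr !inner_self -/q.
  rewrite (innerC u v) -/z conjc_real.
  by clearbody z q; move: (_ ^+ 2)%:C (z^*%C) => U zc; ring.
rewrite inner_self => /complexI ww.
have : 0 <= q * norm2 u ^+ 2 - modsq z.
  by rewrite -(pmulr_rge0 _ qp) -ww sqr_ge0.
rewrite subr_ge0 /modsq /q -exprMn mulrC.
by rewrite ler_pXn2r ?nnegrE ?mulr_ge0 ?norm2_ge0 ?normc_ge0.
Qed.

Lemma norm2D u v : norm2 (u + v) <= norm2 u + norm2 v.
Proof.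
rewrite -(ler_pXn2r (_ : (0 < 2)%N)) ?nnegrE ?addr_ge0 ?norm2_ge0//.
have : inner (u + v) (u + v) =
    (norm2 u ^+ 2 + 2 * complex.Re (inner u v) + norm2 v ^+ 2)%:C.
  rewrite innerDl !innerDr !inner_self [inner v u]innerC.
  case: (inner u v) => p q; apply/eqP; rewrite eq_complex /=.
  by apply/andP; split; apply/eqP; ring.
rewrite inner_self => /complexI ->.
have := le_trans (normc_Re _) (cauchy_schwarz u v); rewrite ler_norml.
by move=> /andP[_]; rewrite sqrrD; lra.
Qed.

Lemma norm2Z a u : norm2 (a *: u) = Normc.normc a * norm2 u.
Proof.
apply: (@pexpIrn _ 2); rewrite ?nnegrE ?mulr_ge0 ?norm2_ge0 ?normc_ge0//.
apply: complexI; rewrite -inner_self innerZl innerZr inner_self mulrA mulCJ.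
by rewrite -rmorphM /= exprMn.
Qed.

Lemma norm2N u : norm2 (- u) = norm2 u.
Proof. by rewrite -scaleN1r norm2Z -[-1]/(-1) normcN Normc.normc1 mul1r. Qed.

Lemma norm20 : norm2 (0 : H) = 0.
Proof. by rewrite -(scale0r (0 : H)) norm2Z Normc.normc0 mul0r. Qed.

Lemma norm2_delta s : norm2 (delta R s) = 1.
Proof.
apply: (@pexpIrn _ 2); rewrite ?nnegrE ?norm2_ge0// expr1n.
by apply: complexI; rewrite -inner_self inner_delta delta_eq.
Qed.

Lemma normc_le_norm2 u t : Normc.normc (u t) <= norm2 u.
Proof.
by have := cauchy_schwarz u (delta R t); rewrite inner_delta norm2_delta mulr1.
Qed.

Lemma norm2_triangle v u w : norm2 (u - w) <= norm2 (u - v) + norm2 (v - w).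
Proof. by rewrite -[u - w](subrKA v) norm2D. Qed.

Lemma norm2_distC u v : norm2 (u - v) = norm2 (v - u).
Proof. by rewrite -norm2N opprB. Qed.

Lemma norm2_closed u v : (forall e, 0 < e -> norm2 (u - v) <= e) -> u = v.
Proof.
move=> uv; apply/eqP; rewrite -subr_eq0; apply/eqP/norm2_eq0/eqP.
by rewrite eq_le norm2_ge0 andbT; apply/ler_addgt0Pl => e /uv; rewrite addr0.
Qed.

Lemma cutoff_subproof (A : set G) u :
  (fun t => if t \in A then u t else 0) \in @sqsummable_pred R G.
Proof.
apply: sqsummableP; apply: le_lt_trans (l2_summing u); apply: le_nsum => t.
by case: ifP => _ //; rewrite /modsq Normc.normc0 expr0n modsq_ge0.
Qed.

Definition cutoff (A : set G) u : H := L2 (cutoff_subproof A u).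

Lemma cutoff_in A u t : A t -> cutoff A u t = u t.
Proof. by move=> At /=; rewrite mem_set. Qed.

Lemma cutoff_out A u t : ~ A t -> cutoff A u t = 0.
Proof. by move=> At /=; rewrite memNset. Qed.

Lemma cutoff_linear A : linear (cutoff A).
Proof.
move=> a u v; apply: l2_ext => t; rewrite l2D l2Z.
have [At|At] := pselect (A t); first by rewrite !cutoff_in.
by rewrite !cutoff_out// mulr0 addr0.
Qed.

Lemma inner_cutoff A u v : inner (cutoff A u) v = inner u (cutoff A v).
Proof.
rewrite /inner; congr csum; apply/funext => t.
have [At|At] := pselect (A t); first by rewrite !cutoff_in.
by rewrite !cutoff_out// mul0r conjc0 mulr0.
Qed.

Lemma norm2_le u v : (forall t, modsq (u t) <= modsq (v t)) ->
  norm2 u <= norm2 v.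
Proof.
move=> uv; rewrite -(ler_pXn2r (_ : (0 < 2)%N)) ?nnegrE ?norm2_ge0//.
by rewrite -lee_fin !norm2_sq; exact: le_nsum.
Qed.

Lemma norm2_cutoff A u : norm2 (cutoff A u) <= norm2 u.
Proof.
apply: norm2_le => t; have [At|At] := pselect (A t); first by rewrite cutoff_in.
by rewrite cutoff_out// /modsq Normc.normc0 expr0n modsq_ge0.
Qed.

(** A finite set carrying almost all of the sum of the squared moduli leaves a
    small remainder. *)
Lemma finite_support_dense u e : 0 < e ->
  exists2 s : seq G, uniq s & norm2 (u - cutoff [set` s] u) <= e.
Proof.
move=> e0; have e20 : 0 < e ^+ 2 by rewrite exprn_gt0.
have u0 t : 0 <= modsq (u t) by exact: modsq_ge0.
have [s us lt] := nsum_approx u0 (l2_summing u) e20; exists s => //.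
rewrite -(ler_pXn2r (_ : (0 < 2)%N)) ?nnegrE ?norm2_ge0 ?(ltW e0)//.
have : nsum (fun t => modsq (u t)) = (nsum (fun t => modsq (cutoff [set` s] u
  t)) +
    nsum (fun t => modsq ((u - cutoff [set` s] u)%R t)))%E.
  rewrite -nsumD => [|t|t]; rewrite ?modsq_ge0//; congr nsum; apply/funext => t.
  rewrite l2B; have [As|As] := pselect ([set` s] t).
    by rewrite cutoff_in// subrr /modsq Normc.normc0 [0 ^+ 2]expr0n addr0.
  by rewrite cutoff_out// subr0 /modsq Normc.normc0 [0 ^+ 2]expr0n add0r.
have : ((\sum_(t <- s) modsq (u t))%:E <=
    nsum (fun t => modsq (cutoff [set` s] u t)))%E.
  rewrite (eq_big_seq (fun t => modsq (cutoff [set` s] u t))).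
    exact: nsum_ge_seq.
  by move=> t ts; rewrite cutoff_in.
move: lt; rewrite -!norm2_sq -EFinD !lte_fin lee_fin => lt le [E]; lra.
Qed.

Lemma cutoff_cons x (s : seq G) u : x \notin s ->
  cutoff [set` x :: s] u = u x *: delta R x + cutoff [set` s] u.
Proof.
move=> xs; apply: l2_ext => t; rewrite l2D l2Z.
have [->|tx] := eqVneq t x.
  rewrite delta_eq mulr1 cutoff_in; last by rewrite /= mem_head.
  by rewrite cutoff_out ?addr0//; exact/negP.
rewrite delta_neq ?mulr0 ?add0r; last exact/eqP.
have [ts|ts] := pselect (t \in s); first by rewrite !cutoff_in//;
  rewrite /= inE ts orbT.
by rewrite !cutoff_out//; rewrite /= inE (negbTE tx).
Qed.

Lemma cutoff0 u : cutoff [set` [::]] u = 0.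
Proof. by apply: l2_ext => t; rewrite cutoff_out. Qed.

Definition finite_vector (r : seq G) (f : G -> C) : H :=
  \sum_(t <- r) f t *: delta R t.

Lemma finite_vector_in (r : seq G) (f : G -> C) t : uniq r -> t \in r ->
  finite_vector r f t = f t.
Proof.
move=> ur tr; rewrite /finite_vector l2_sum (bigD1_seq t)// l2Z delta_eq mulr1.
rewrite big1 ?[LHS]addr0// => q qt; rewrite l2Z delta_neq ?mulr0//.
by move=> tq; rewrite tq eqxx in qt.
Qed.

(** Density of the finitely supported functions as an induction principle: a
    property closed under linear combinations and norm limits need only be
    checked on the point masses. *)
Lemma l2_ind (Q : H -> Prop) : (forall t, Q (delta R t)) ->
  (forall a u v, Q u -> Q v -> Q (a *: u + v)) ->
  (forall u, (forall e, 0 < e -> exists2 v, Q v & norm2 (u - v) <= e) -> Q u) ->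
  forall u, Q u.
Proof.
move=> Qd Ql Qc u; have Q0 : Q 0.
  by have := Ql (-1) _ _ (Qd 1%g) (Qd 1%g); rewrite scaleN1r addNr.
apply: Qc => e /(finite_support_dense u)[s us se];
  exists (cutoff [set` s] u) => //.
elim: s us {se} => [_|x s IH /= /andP[xs us]]; first by rewrite cutoff0.
by rewrite cutoff_cons//; apply: Ql => //; exact: IH.
Qed.

Lemma nsum_norm2_le u (M : R) : 0 <= M ->
  (nsum (fun t => modsq (u t)) <= (M ^+ 2)%:E)%E -> norm2 u <= M.
Proof.
move=> M0; rewrite -norm2_sq lee_fin => h.
by rewrite -(ler_pXn2r (_ : (0 < 2)%N)) ?nnegrE ?norm2_ge0.
Qed.

End SquareSummable.

(** * Bounded operators, adjoints and commutants *)

Section BoundedOperators.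
Variables (R : realType) (G : groupType).
Local Notation C := R[i].
Local Notation H := (l2 R G).
Local Notation op := (H -> H).
Implicit Types (u v w : H) (a c : C) (s t : G) (S T : op).

Section LinearMaps.
Variable T : op.
Hypothesis Tlin : linear T.

Lemma op_linD u v : T (u + v) = T u + T v.
Proof. by rewrite -[u in LHS]scale1r Tlin scale1r. Qed.

Lemma op_lin0 : T 0 = 0.
Proof. by apply: (addrI (T 0)); rewrite -op_linD !addr0. Qed.

Lemma op_linZ a u : T (a *: u) = a *: T u.
Proof. by rewrite -[a *: u]addr0 Tlin op_lin0 addr0. Qed.

Lemma op_linB u v : T (u - v) = T u - T v.
Proof. by rewrite op_linD -scaleN1r op_linZ scaleN1r. Qed.

Lemma op_lin_sum (I : Type) (r : seq I) (F : I -> H) :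
  T (\sum_(i <- r) F i) = \sum_(i <- r) T (F i).
Proof. by apply: (big_morph T op_linD op_lin0). Qed.

End LinearMaps.

Lemma bounded_bound T : bounded_ops T ->
  exists2 M : R, 0 <= M & forall u, norm2 (T u) <= M * norm2 u.
Proof.
move=> [_ [M TM]]; exists (Num.max M 0); first by rewrite le_max lexx orbT.
move=> u; apply: le_trans (TM u) _; rewrite ler_wpM2r ?norm2_ge0//.
by rewrite le_max lexx.
Qed.

Lemma bounded_id : bounded_ops (idfun : op).
Proof. by split=> [a u v|] //; exists 1 => u; rewrite mul1r. Qed.

Lemma bounded_comp S T : bounded_ops S -> bounded_ops T -> bounded_ops (S \o T).
Proof.
move=> Sb Tb; split=> [a u v|] /=; first by rewrite Tb.1 Sb.1.
have [M M0 SM] := bounded_bound Sb; have [K K0 TK] := bounded_bound Tb.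
exists (M * K) => u; apply: le_trans (SM _) _.
by rewrite -mulrA ler_wpM2l.
Qed.

Lemma bounded_combination a S T :
  bounded_ops S -> bounded_ops T -> bounded_ops (a *: S + T).
Proof.
move=> Sb Tb; split=> [c u v|].
  rewrite -[LHS]/(a *: S (c *: u + v) + T (c *: u + v)).
  rewrite -[RHS]/(c *: (a *: S u + T u) + (a *: S v + T v)) Sb.1 Tb.1.
  by rewrite !scalerDr !scalerA [c * a]mulrC addrACA.
have [M M0 SM] := bounded_bound Sb; have [K K0 TK] := bounded_bound Tb.
exists (Normc.normc a * M + K) => u.
apply: le_trans (norm2D (a *: S u) (T u)) _;
  rewrite mulrDl lerD// norm2Z -mulrA.
by rewrite ler_wpM2l// normc_ge0.
Qed.

Lemma bounded_eq S T : bounded_ops S -> bounded_ops T ->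
  (forall t, S (delta R t) = T (delta R t)) -> S = T.
Proof.
move=> Sb Tb ST; apply/funext; apply: l2_ind => // [a u v Su Sv|u uc].
  by rewrite Sb.1 Tb.1 Su Sv.
have [M M0 SM] := bounded_bound Sb; have [K K0 TK] := bounded_bound Tb.
apply: norm2_closed => e e0.
(* the summand 1 keeps the denominator positive when both bounds vanish *)
have MK : 0 < M + K + 1 by rewrite ltr_wpDl// addr_ge0.
have [v Tv uv] := uc (e / (M + K + 1)) (divr_gt0 e0 MK).
apply: le_trans (norm2_triangle (S v) _ _) _.
rewrite {2}Tv -(op_linB Sb.1) -(op_linB Tb.1).
apply: (@le_trans _ _ (M * norm2 (u - v) + K * norm2 (v - u))).
  by rewrite lerD.
rewrite (norm2_distC v) -mulrDl.
apply: (@le_trans _ _ ((M + K + 1) * norm2 (u - v))).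
  by rewrite ler_wpM2r ?norm2_ge0// lerDl.
by rewrite mulrC -ler_pdivlMr.
Qed.

Lemma inner_ext u v : (forall w, inner u w = inner v w) -> u = v.
Proof. by move=> uv; apply: l2_ext => t; rewrite -!inner_delta uv. Qed.

Lemma inner_extr u v : (forall w, inner w u = inner w v) -> u = v.
Proof. by move=> uv; apply: inner_ext => w; rewrite innerC uv -innerC. Qed.

(** The adjoint is prescribed by its coordinates: [S v] at [t] has to be the
    inner product of [v] with [T delta_t].  Testing against the finitely
    supported vector with these coordinates bounds the sum of their squared
    moduli by [(M * norm2 v) ^+ 2]. *)
Lemma adjoint_exists T : bounded_ops T ->
  exists2 S, bounded_ops S & forall u v, inner (T u) v = inner u (S v).
Proof.
move=> Tb; have [M M0 TM] := bounded_bound Tb.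
pose f v t := inner v (T (delta R t)).
have bound v : (nsum (fun t => modsq (f v t)) <= ((M * norm2 v) ^+ 2)%:E)%E.
  apply: nsum_le_seq => s us; rewrite lee_fin.
  set X := \sum_(t <- s) _; pose phi := finite_vector s (f v).
  have X0 : 0 <= X by apply: sumr_ge0 => t _; exact: modsq_ge0.
  have phiE : inner phi phi = X%:C.
    rewrite /X rmorph_sum /= {1}/phi {1}/finite_vector.
    rewrite (big_morph (fun u => inner u phi) (fun x y => innerDl x y phi)
      (inner0l phi)).
    apply: eq_big_seq => t ts; rewrite innerZl inner_deltal finite_vector_in//.
    exact: mulCJ.
  have vphi : inner v (T phi) = X%:C.
    rewrite /phi /finite_vector (op_lin_sum Tb.1).
    rewrite (big_morph (inner v) (fun x y => innerDr x y v) (inner0r v)).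
    rewrite /X rmorph_sum /=; apply: eq_bigr => t _.
    by rewrite (op_linZ Tb.1) innerZr -mulCJ mulrC.
  have : X <= norm2 v * (M * norm2 phi).
    have := cauchy_schwarz v (T phi); rewrite vphi normc_real ger0_norm//.
    move=> /le_trans; apply; rewrite ler_wpM2l ?norm2_ge0//.
  have : X = norm2 phi ^+ 2 by apply: complexI; rewrite -phiE inner_self.
  move=> ->; have := norm2_ge0 phi; have := norm2_ge0 v.
  move: (norm2 phi) (norm2 v) => p q q0 p0 h.
  rewrite ler_pXn2r ?nnegrE ?mulr_ge0//.
  have [->|pn0] := eqVneq p 0; first by rewrite mulr_ge0.
  have pp : 0 < p by rewrite lt_neqAle eq_sym pn0.
  rewrite -(ler_pM2r pp) -expr2; apply: le_trans h _.
  by rewrite mulrCA mulrA.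
have fs v : f v \in @sqsummable_pred R G.
  by apply: sqsummableP; apply: le_lt_trans (bound v) (ltry _).
pose S v : H := L2 (fs v).
have Slin : linear S.
  by move=> a u v; apply: l2_ext => t; rewrite l2D l2Z /= /f inner_linear.
have Sb : bounded_ops S.
  split; first exact: Slin.
  exists M => v; have Mv : 0 <= M * norm2 v by rewrite mulr_ge0 ?norm2_ge0.
  exact: (@nsum_norm2_le _ _ (S v) _ Mv (bound v)).
exists S => //; move=> u v; rewrite [RHS]innerC [LHS]innerC.
congr (_^*%C).
move: u; apply: l2_ind => [t|a u w IHu IHw|u uc].
- by rewrite inner_delta.
- by rewrite (op_linD Tb.1) (op_linZ Tb.1) !innerDr !innerZr IHu IHw.
apply/eqP; rewrite -subr_eq0; apply/eqP/Normc.eq0_normc/eqP.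
rewrite eq_le normc_ge0 andbT; apply/ler_addgt0Pl => e e0; rewrite addr0.
have nv0 := norm2_ge0 v; have nS0 := norm2_ge0 (S v).
have Kp : 0 < norm2 v * M + norm2 (S v) + 1.
  by rewrite ltr_wpDl// addr_ge0// mulr_ge0.
have [w Qw uw] := uc _ (divr_gt0 e0 Kp).
rewrite -[u](subrK w) (op_linD Tb.1) !innerDr Qw.
rewrite opprD addrACA subrr addr0.
apply: le_trans (le_normcD _ _) _; rewrite normcN.
apply: (@le_trans _ _ ((norm2 v * M + norm2 (S v) + 1) * norm2 (u - w))).
  rewrite mulrDl mul1r -[X in X <= _]addr0 lerD ?norm2_ge0// mulrDl lerD//.
    apply: le_trans (cauchy_schwarz _ _) _.
    by rewrite -mulrA ler_wpM2l.
  by rewrite -innerDr; exact: cauchy_schwarz.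
by rewrite mulrC -ler_pdivlMr.
Qed.

Lemma adjoint_unique T S :
  (forall u v, inner (T u) v = inner u (S v)) -> adjoint T = S.
Proof.
move=> TS; rewrite /adjoint; case: xgetP => [S' _ /= TS'|/(_ S)] //.
by apply/funext => v; apply: inner_extr => u; rewrite -TS' TS.
Qed.

Lemma adjointP T : bounded_ops T ->
  bounded_ops (adjoint T) /\ forall u v, inner (T u) v = inner u (adjoint T v).
Proof. by move=> /adjoint_exists[S Sb TS]; rewrite (adjoint_unique TS). Qed.

Lemma adjointPr T : bounded_ops T ->
  forall u v, inner (adjoint T u) v = inner u (T v).
Proof. by move=> /adjointP[_ TS] u v; rewrite innerC -TS -innerC. Qed.

Lemma adjointK T : bounded_ops T -> adjoint (adjoint T) = T.
Proof. by move=> Tb; apply: adjoint_unique; exact: adjointPr. Qed.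

Lemma adjoint_comp S T : bounded_ops S -> bounded_ops T ->
  adjoint (S \o T) = adjoint T \o adjoint S.
Proof.
move=> Sb Tb; apply: adjoint_unique => u v /=.
by rewrite (adjointP Sb).2 (adjointP Tb).2.
Qed.

Definition star_closed (A : set op) : Prop := forall T, A T -> A (adjoint T).

Lemma commutant_anti (A B : set op) : A `<=` B -> commutant B `<=` commutant A.
Proof. by move=> AB T [Tb TB]; split=> // S /AB/TB. Qed.

Lemma sub_bicommutant (A : set op) : A `<=` @bounded_ops R G ->
  A `<=` commutant (commutant A).
Proof. by move=> Ab T AT; split; [exact: Ab|move=> S [_ SA]; rewrite SA]. Qed.

Lemma commutant_star (A : set op) : A `<=` @bounded_ops R G -> star_closed A ->
  star_closed (commutant A).
Proof.
move=> Ab As T [Tb TA]; split=> [|S AS]; first by have [] := adjointP Tb.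
have ASb := Ab _ (As _ AS).
have /(congr1 (@adjoint R G)) := TA _ (As _ AS).
by rewrite (adjoint_comp Tb ASb) (adjoint_comp ASb Tb) (adjointK (Ab _ AS)).
Qed.

(** The triple commutant is the commutant. *)
Lemma commutant_von_neumann (A : set op) : A `<=` @bounded_ops R G ->
  star_closed A -> von_neumann (commutant A).
Proof.
move=> Ab As; have cb (B : set op) : commutant B `<=` @bounded_ops R G by
  move=> T [].
split=> //; first exact: commutant_star.
apply/seteqP; split; last exact: sub_bicommutant.
exact/commutant_anti/sub_bicommutant.
Qed.

Lemma vN_generatedE (A : set op) : A `<=` @bounded_ops R G -> star_closed A ->
  vN_generated A = commutant (commutant A).
Proof.
move=> Ab As; apply/seteqP; split; last first.
  move=> T TA M [[_ _ ME] AM]; rewrite -ME.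
  exact: (commutant_anti (commutant_anti AM)) TA.
apply: smallest_sub; last exact: sub_bicommutant.
by apply: commutant_von_neumann => [T []//|]; exact: commutant_star.
Qed.

Lemma vN_generated_von_neumann (A : set op) :
  A `<=` @bounded_ops R G -> star_closed A -> von_neumann (vN_generated A).
Proof.
move=> Ab As; rewrite vN_generatedE//;
  apply: commutant_von_neumann => [T []//|].
exact: commutant_star.
Qed.

Section VonNeumannClosure.
Variable M : set op.
Hypothesis vM : von_neumann M.

Lemma vN_adjoint T : M T -> M (adjoint T). Proof. by have [_ + _] := vM;
  exact. Qed.

Lemma vN_id : M idfun.
Proof. by have [_ _ <-] := vM; split; [exact: bounded_id|]. Qed.

Lemma vN_comp S T : M S -> M T -> M (S \o T).
Proof.
have [_ _ <-] := vM => -[Sb SM] [Tb TM]; split; first exact: bounded_comp.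
by move=> K MK; rewrite -compA TM// compA SM.
Qed.

Lemma vN_combination a S T : M S -> M T -> M (a *: S + T).
Proof.
have [_ _ <-] := vM => -[Sb SM] [Tb TM]; split;
  first exact: bounded_combination.
move=> K MK; apply/funext => u.
rewrite -[LHS]/(a *: S (K u) + T (K u)) -[RHS]/(K (a *: S u + T u)).
rewrite MK.1.1.
by rewrite -[S (K u)]/((S \o K) u) -[T (K u)]/((T \o K) u) SM// TM.
Qed.
End VonNeumannClosure.

End BoundedOperators.

(** * Coefficient functions and the algebra of a subgroup *)

Section RegularRepresentations.
Variables (R : realType) (G : groupType).
Local Notation C := R[i].
Local Notation H := (l2 R G).
Local Notation op := (H -> H).
Implicit Types (u v w : H) (a c : C) (s t g : G) (S T x y : op) (K : set G).

Lemma csum_bij (f : G -> C) (e : G -> G) : bijective e -> csum (f \o e) = csum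
  f.
Proof.
move=> be; rewrite /csum -(rsum_bij (fun r => complex.Re (f r)) be).
by rewrite -(rsum_bij (fun r => complex.Im (f r)) be).
Qed.

(** The matrix of an operator acts by an absolutely convergent sum, because the
    row of index [t] is conjugate to the coordinates of the adjoint at
    [delta_t]. *)
Lemma op_matrix x v t : bounded_ops x ->
  x v t = csum (fun r => v r * x (delta R r) t).
Proof.
move=> xb; rewrite -inner_delta (adjointP xb).2 /inner; congr csum.
apply/funext => r; congr (_ * _).
by rewrite -(inner_delta (x _)) (adjointP xb).2 inner_deltal.
Qed.

Lemma bij_mulg s : bijective (fun t => s * t)%g.
Proof. by exists (fun t => s^-1 * t)%g => t; rewrite ?mulKg ?mulVKg. Qed.

Lemma bij_mulgr s : bijective (fun t => t * s)%g.
Proof. by exists (fun t => t * s^-1)%g => t; rewrite ?mulgK ?mulgVK. Qed.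

Lemma right_regular_subproof s u :
  (fun t => u (t * s)%g) \in @sqsummable_pred R G.
Proof.
apply: sqsummableP; rewrite /summing.
by rewrite (nsum_bij (fun t => modsq (u t)) (bij_mulgr s)); exact: l2_summing.
Qed.

Definition right_regular s : op := fun u => L2 (right_regular_subproof s u).

Local Notation L := (@left_regular R G).
Local Notation Rr := right_regular.

Lemma left_regular_linear s : linear (L s).
Proof. by move=> a u v; apply: l2_ext. Qed.

Lemma right_regular_linear s : linear (Rr s).
Proof. by move=> a u v; apply: l2_ext. Qed.

Lemma norm2_left_regular s u : norm2 (L s u) = norm2 u.
Proof.
by congr (Num.sqrt (fine _));
  exact: (nsum_bij (fun t => modsq (u t)) (bij_mulg _)).
Qed.

Lemma norm2_right_regular s u : norm2 (Rr s u) = norm2 u.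
Proof.
by congr (Num.sqrt (fine _));
  exact: (nsum_bij (fun t => modsq (u t)) (bij_mulgr _)).
Qed.

Lemma left_regular_bounded s : bounded_ops (L s).
Proof.
split; first exact: left_regular_linear.
by exists 1 => u; rewrite norm2_left_regular mul1r.
Qed.

Lemma right_regular_bounded s : bounded_ops (Rr s).
Proof.
split; first exact: right_regular_linear.
by exists 1 => u; rewrite norm2_right_regular mul1r.
Qed.

Lemma left_regularE s u t : L s u t = u (s^-1 * t)%g. Proof. by []. Qed.
Lemma right_regularE s u t : Rr s u t = u (t * s)%g. Proof. by []. Qed.

Lemma deltaE s t : delta R s t = (t == s)%:R. Proof. by []. Qed.

Lemma left_regular_delta s t : L s (delta R t) = delta R (s * t)%g.
Proof.
apply: l2_ext => g; rewrite left_regularE !deltaE.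
by rewrite -[in RHS](inj_eq (mulgI s^-1%g)) mulKg.
Qed.

Lemma right_regular_delta s t : Rr s (delta R t) = delta R (t * s^-1)%g.
Proof.
apply: l2_ext => g; rewrite right_regularE !deltaE.
by rewrite -[in RHS](inj_eq (mulIg s)) mulgVK.
Qed.

Lemma left_regularM s t : L (s * t)%g = L s \o L t.
Proof.
by apply/funext => u; apply: l2_ext => g /=;
  rewrite /left_translation_fun invgM mulgA.
Qed.

Lemma left_regular1 : L 1%g = idfun.
Proof.
by apply/funext => u; apply: l2_ext => g; rewrite left_regularE invg1 mul1g.
Qed.

Lemma left_right_commute s t : L s \o Rr t = Rr t \o L s.
Proof.
by apply/funext => u; apply: l2_ext => g /=;
  rewrite /left_translation_fun /= mulgA.
Qed.

Lemma adjoint_left_regular s : adjoint (L s) = L s^-1%g.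
Proof.
apply: adjoint_unique => u v; rewrite /inner.
rewrite -(csum_bij (fun r => u r * _) (bij_mulg s^-1%g)); congr csum.
by apply/funext => r /=; rewrite /left_translation_fun invgK mulVKg.
Qed.

Definition right_coset K t : set G := [set g | K (g * t^-1)%g].

Lemma cutoff_bounded (A : set G) : bounded_ops (@cutoff R G A).
Proof.
split; first exact: cutoff_linear.
by exists 1 => u; rewrite mul1r norm2_cutoff.
Qed.

Definition right_invariant x : Prop := forall t, x \o Rr t = Rr t \o x.

Definition coef x : G -> C := fun t => x (delta R 1%g) t.

Lemma right_invariantE x s t : right_invariant x ->
  x (delta R s) t = coef x (t * s^-1)%g.
Proof.
move=> xR; rewrite -[s in LHS]mul1g -{1}[s]invgK -right_regular_delta.
by rewrite -[x (Rr _ _)]/((x \o Rr _) _) xR.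
Qed.

Lemma coef_inj x y : bounded_ops x -> bounded_ops y ->
  right_invariant x -> right_invariant y -> coef x =1 coef y -> x = y.
Proof.
move=> xb yb xR yR xy; apply: bounded_eq => // s; apply: l2_ext => t.
by rewrite !right_invariantE.
Qed.

Definition supported_in K x : Prop := forall t, ~ K t -> coef x t = 0.

Section Subgroup.
Variable K : set G.
Hypothesis KG : subgroup_set K.

Lemma left_image_bounded : L @` K `<=` @bounded_ops R G.
Proof. by move=> _ [s _ <-]; exact: left_regular_bounded. Qed.

Lemma left_image_star : star_closed (L @` K).
Proof.
move=> _ [s Ks <-]; exists s^-1%g; last by rewrite adjoint_left_regular.
by have [_ _ KV] := KG; exact: KV.
Qed.

Lemma left_regular_cutoff_coset s t : K s ->
  L s \o cutoff (right_coset K t) = cutoff (right_coset K t) \o L s.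
Proof.
move=> Ks; have [_ KM KV] := KG; apply/funext => u; apply: l2_ext => g.
rewrite /comp left_regularE.
have [Kg|Kg] := pselect (right_coset K t g).
  rewrite !cutoff_in//; rewrite /right_coset /= -mulgA; apply: KM => //;
    exact: KV.
rewrite !cutoff_out//; rewrite /right_coset /= -mulgA => Kg'; apply: Kg.
by have := KM _ _ Ks Kg'; rewrite mulVKg.
Qed.

(** That L(K) is contained in the right-hand side holds because right
    translations and restrictions to right cosets of [K] commute with the
    generators.  Conversely, let [T] commute with [L s] for [s] in [K].  The
    matrix coefficients of [x \o T] and [T \o x] are two sums over the group
    which become equal term by term after the substitution
    [g = t * r^-1 * s]. *)
Lemma group_vNP x : group_vN R K x <->
  [/\ bounded_ops x, right_invariant x & supported_in K x].
Proof.
rewrite /group_vN (vN_generatedE left_image_bounded left_image_star).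
split=> [[xb xK]|[xb xR xK]].
  split=> // [t|t Kt].
    apply: xK; split; first exact: right_regular_bounded.
    by move=> _ [s Ks <-]; rewrite left_right_commute.
  have xc : x \o cutoff (right_coset K 1%g) = cutoff (right_coset K 1%g) \o x.
    apply: xK; split; first exact: cutoff_bounded.
    by move=> _ [s Ks <-]; rewrite left_regular_cutoff_coset.
  have dc : cutoff (right_coset K 1%g) (delta R 1%g) = delta R 1%g.
    apply: l2_ext => g; have [->|g1] := pselect (g = 1%g); last first.
      have [Kg|Kg] := pselect (right_coset K 1%g g); first by rewrite cutoff_in.
      by rewrite cutoff_out// delta_neq.
    by rewrite cutoff_in// /right_coset /= mulgV; have [] := KG.
  rewrite /coef -dc -[x (cutoff _ _)]/((x \o cutoff _) _) xc /comp cutoff_out//.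
  by rewrite /right_coset /= invg1 mulg1.
split=> // T [Tb TK].
have xTb := bounded_comp xb Tb; have Txb := bounded_comp Tb xb.
apply: bounded_eq => // s; apply: l2_ext => t; rewrite /comp.
rewrite [LHS]op_matrix// [RHS]op_matrix//.
(* r = h^-1 t and g = h s run through the group together, with h = t r^-1 *)
have be : bijective (fun r => t * r^-1 * s)%g.
  exists (fun g => s * g^-1 * t)%g => g.
    by rewrite !invgM invgK !mulgA mulgV mul1g mulgVK.
  by rewrite !invgM invgK !mulgA mulgV mul1g mulgVK.
rewrite -[RHS](csum_bij _ be); congr csum; apply/funext => r /=.
rewrite (right_invariantE r t xR) (right_invariantE s _ xR) mulgK.
have [Kr|Kr] := pselect (K (t * r^-1)%g); last by rewrite xK// mulr0 mul0r.
rewrite mulrC; congr (_ * _); rewrite -left_regular_delta.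
rewrite -[T (L _ _)]/((T \o L _) _) TK; last by exists (t * r^-1)%g.
by rewrite /= /left_translation_fun invgM invgK mulgVK.
Qed.

Lemma group_vN_von_neumann : von_neumann (group_vN R K).
Proof. exact: vN_generated_von_neumann left_image_bounded left_image_star. Qed.

Lemma group_vN_left s : K s -> group_vN R K (L s).
Proof. by move=> Ks M [_ LM]; apply: LM; exists s. Qed.

End Subgroup.

Lemma coef_left s t : coef (L s) t = (t == s)%:R.
Proof. by rewrite /coef left_regular_delta mulg1. Qed.

Lemma coef_comp_left s x t : coef (L s \o x) t = coef x (s^-1 * t)%g.
Proof. by []. Qed.

Lemma coef_left_comp s x t : right_invariant x ->
  coef (x \o L s) t = coef x (t * s^-1)%g.
Proof.
by move=> xR; rewrite /coef /= left_regular_delta mulg1 right_invariantE.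
Qed.

Lemma coef_Ad_left s x t : right_invariant x ->
  coef (Ad_left s x) t = coef x (s^-1 * t * s)%g.
Proof.
move=> xR; rewrite /Ad_left /Ad adjoint_left_regular coef_comp_left.
by rewrite coef_left_comp// invgK.
Qed.

Lemma trace_coef x : canonical_trace x = coef x 1%g.
Proof. exact: inner_delta. Qed.

Lemma coef_combination a x y t : coef (a *: x + y) t = a * coef x t + coef y t.
Proof. by []. Qed.

Lemma coef_adjoint x t : bounded_ops x -> right_invariant x ->
  coef (adjoint x) t = (coef x t^-1%g)^*%C.
Proof.
move=> xb xR; rewrite /coef -inner_delta (adjointPr xb) inner_deltal.
by rewrite right_invariantE// mul1g.
Qed.

End RegularRepresentations.

(** * Conditional expectations and commuting squares *)

Section ConditionalExpectation.
Variables (R : realType) (G : groupType).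
Local Notation C := R[i].
Local Notation H := (l2 R G).
Local Notation op := (H -> H).
Implicit Types (u v w : H) (a c : C) (s t g r : G) (S T x y : op) (J K : set G).

Lemma complex_ge0_closed (z : C) :
  (forall e : R, 0 < e -> exists2 z', 0 <= z' & Normc.normc (z - z') <= e) ->
  0 <= z.
Proof.
move=> zc; rewrite lecE; apply/andP; split.
  rewrite -normr_eq0 eq_le normr_ge0 andbT; apply/ler_addgt0Pl => e /zc[z'].
  rewrite lecE addr0 => /andP[/eqP /= Iz' _]; apply: le_trans.
  apply: le_trans (normc_Im _); case: (z) Iz' => p q; case: z' => p' q' /= ->.
  by rewrite subr0.
rewrite /= -oppr_le0; apply/ler_addgt0Pl => e /zc[z'].
rewrite lecE addr0 => /andP[_ /= Rz']; apply: le_trans.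
apply: le_trans (normc_Re _); case: (z) => p q; case: z' Rz' => p' q' /= p'0.
by rewrite ler_normr; apply/orP; right; lra.
Qed.

Section Subgroup.
Variable K : set G.
Hypothesis KG : subgroup_set K.
Local Notation coset t := (right_coset K t).

Lemma right_coset_refl t : coset t t.
Proof. by have [K1 _ _] := KG; rewrite /right_coset /= mulgV. Qed.

Lemma right_coset_eq t r : coset r t -> coset t = coset r.
Proof.
have [_ KM KV] := KG; rewrite /right_coset /= => tr; apply/seteqP;
  split=> g /= gt.
  by have := KM _ _ gt tr; rewrite mulgA mulgVK.
by have := KM _ _ gt (KV _ tr); rewrite invgM invgK mulgA mulgVK.
Qed.

(** A choice of representatives, so that the right cosets become the fibres of a
    map and sums can be taken coset by coset. *)
Definition coset_repr t : G := xget 1%g (coset t).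

Lemma coset_repr_in t : coset t (coset_repr t).
Proof.
by rewrite /coset_repr; case: xgetP => // /(_ t); have := right_coset_refl t.
Qed.

Lemma coset_fiber t : [set g | coset_repr g = coset_repr t] = coset t.
Proof.
apply/seteqP; split=> g /= => [gt|/right_coset_eq gt];
  last by rewrite /coset_repr gt.
have <- := right_coset_eq (coset_repr_in t).
rewrite -gt (right_coset_eq (coset_repr_in g)); exact: right_coset_refl.
Qed.

Lemma group_vN_cutoff x t : group_vN R K x ->
  x \o cutoff (coset t) = cutoff (coset t) \o x.
Proof.
rewrite /group_vN (vN_generatedE (left_image_bounded (K := K)) (left_image_star
  KG)).
move=> [_ xK]; apply: xK; split; first exact: cutoff_bounded.
by move=> _ [s Ks <-]; rewrite left_regular_cutoff_coset.
Qed.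

(** The block diagonal part of [x] along the right cosets of [K].  The default
    value 0 can only occur for unbounded [x]. *)
Definition group_expectation x : op :=
  fun u => insubd (0 : H) (fun t => x (cutoff (coset t) u) t).

(** The blocks act on orthogonal pieces of [u], so the norm of the
    block diagonal part is at most that of [x]. *)
Lemma group_expectation_sum x u (M : R) : 0 <= M ->
  (forall v, norm2 (x v) <= M * norm2 v) ->
  (nsum (fun t => modsq (x (cutoff (coset t) u) t)) <=
    ((M * norm2 u) ^+ 2)%:E)%E.
Proof.
move=> M0 xM; pose F r : set G := [set g | coset_repr g = r].
rewrite (nsum_fiber coset_repr) => [|t]; last exact: modsq_ge0.
rewrite exprMn EFinM norm2_sq -nsumZ ?sqr_ge0// => [|t]; last exact: modsq_ge0.
rewrite [leRHS](nsum_fiber coset_repr) => [|t]; last first.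
  by rewrite mulr_ge0 ?sqr_ge0 ?modsq_ge0.
apply: le_esum => r _.
apply: (@le_trans _ _ (nsum (fun t => modsq (x (cutoff (F r) u) t)))).
  apply: le_nsum => t; case: eqP => [tr|_]; last exact: modsq_ge0.
  by rewrite -coset_fiber tr.
apply: (@le_trans _ _ ((M ^+ 2)%:E * nsum (fun t => modsq (cutoff (F r) u
  t)))%E).
  rewrite -!norm2_sq -EFinM lee_fin -exprMn.
  by rewrite ler_pXn2r ?nnegrE ?mulr_ge0 ?norm2_ge0.
rewrite -nsumZ ?sqr_ge0// => [|t]; last exact: modsq_ge0.
apply: le_nsum => t; case: eqP => [tr|tr]; first by rewrite cutoff_in.
by rewrite cutoff_out// /modsq Normc.normc0 [0 ^+ 2]expr0n mulr0.
Qed.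

Lemma group_expectationE x u t : bounded_ops x ->
  group_expectation x u t = x (cutoff (coset t) u) t.
Proof.
move=> xb; have [M M0 xM] := bounded_bound xb.
rewrite /group_expectation insubdK//; apply: sqsummableP.
exact: le_lt_trans (group_expectation_sum u M0 xM) (ltry _).
Qed.

Lemma group_expectation_bound x (M : R) : bounded_ops x -> 0 <= M ->
  (forall v, norm2 (x v) <= M * norm2 v) ->
  forall u, norm2 (group_expectation x u) <= M * norm2 u.
Proof.
move=> xb M0 xM u; apply: nsum_norm2_le; first by rewrite mulr_ge0 ?norm2_ge0.
apply: le_trans (group_expectation_sum u M0 xM).
by apply: le_nsum => t; rewrite group_expectationE.
Qed.

Lemma group_expectation_bounded x : bounded_ops x -> bounded_ops
  (group_expectation x).
Proof.
move=> xb; split.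
  move=> a u v; apply: l2_ext => t; rewrite l2D l2Z !group_expectationE//.
  by rewrite cutoff_linear xb.1.
have [M M0 xM] := bounded_bound xb.
by exists M; exact: group_expectation_bound.
Qed.

Lemma group_expectation_linear c x y : bounded_ops x -> bounded_ops y ->
  group_expectation (c *: x + y) = c *: group_expectation x + group_expectation
    y.
Proof.
move=> xb yb; apply/funext => u; apply: l2_ext => t.
rewrite group_expectationE; last exact: bounded_combination.
by rewrite -[RHS]/(c * group_expectation x u t + group_expectation y u t)
  !group_expectationE.
Qed.

Lemma group_expectation_right_invariant x : bounded_ops x -> right_invariant x
  ->
  right_invariant (group_expectation x).
Proof.
move=> xb xR s; apply/funext => u; apply: l2_ext => t.
rewrite /comp right_regularE !group_expectationE//.
rewrite -right_regularE -[right_regular s (x _)]/((right_regular s \o x) _) -xR.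
congr (x _ t); apply: l2_ext => g; rewrite right_regularE.
have e : coset (t * s)%g (g * s)%g = coset t g.
  by rewrite /right_coset /= invgM mulgA mulgK.
have [tg|tg] := pselect (coset t g); first by rewrite !cutoff_in ?e.
by rewrite !cutoff_out ?e.
Qed.

Lemma coef_group_expectation x t : bounded_ops x ->
  coef (group_expectation x) t = if t \in K then coef x t else 0.
Proof.
move=> xb; have [K1 KM KV] := KG; rewrite /coef group_expectationE//.
have [Kt|Kt] := pselect (K t).
  rewrite mem_set//; congr (x _ t); apply: l2_ext => g.
  have [->|g1] := pselect (g = 1%g).
    by rewrite cutoff_in// /right_coset /= mul1g; exact: KV.
  rewrite delta_neq//; have [tg|tg] := pselect (coset t g).
    by rewrite cutoff_in// delta_neq.
  by rewrite cutoff_out.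
rewrite memNset// (_ : cutoff _ _ = 0) ?(op_lin0 xb.1)//; apply: l2_ext => g.
have [tg|tg] := pselect (coset t g); last by rewrite cutoff_out.
rewrite cutoff_in// delta_neq// => g1; apply: Kt; move: tg.
by rewrite g1 /right_coset /= mul1g => /KV; rewrite invgK.
Qed.

Lemma group_expectation_group_vN x : bounded_ops x -> right_invariant x ->
  group_vN R K (group_expectation x).
Proof.
move=> xb xR; apply/group_vNP => //; split;
  first exact: group_expectation_bounded.
  exact: group_expectation_right_invariant.
by move=> t Kt; rewrite coef_group_expectation// memNset.
Qed.

Lemma group_expectation_fix x : group_vN R K x -> group_expectation x = x.
Proof.
move=> /(group_vNP KG)[xb xR xK]; apply: coef_inj => //.
- exact: group_expectation_bounded.
- exact: group_expectation_right_invariant.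
move=> t; rewrite coef_group_expectation//; have [Kt|Kt] := pselect (K t).
  by rewrite mem_set.
by rewrite memNset// xK.
Qed.

(** Elements of L(K) preserve the functions supported on a given right coset of
    [K], so they pass through the restrictions to cosets. *)
Lemma group_expectation_bimodule (a x b : op) :
  group_vN R K a -> bounded_ops x -> group_vN R K b ->
  group_expectation (a \o x \o b) = a \o group_expectation x \o b.
Proof.
move=> Ka xb Kb; have [ab _ _] := (group_vNP KG a).1 Ka.
have [bb _ _] := (group_vNP KG b).1 Kb.
apply/funext => u; apply: l2_ext => t.
rewrite group_expectationE; last by apply: bounded_comp bb; exact: bounded_comp.
rewrite /comp -[b (cutoff _ _)]/((b \o cutoff _) _) group_vN_cutoff// /comp.
have cosett := right_coset_refl t.
rewrite -[RHS](cutoff_in _ cosett) -[LHS](cutoff_in _ cosett).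
rewrite -![cutoff _ (a _)]/((cutoff _ \o a) _) -group_vN_cutoff// /comp.
congr (a _ t); apply: l2_ext => g; have [tg|tg] := pselect (coset t g).
  by rewrite !cutoff_in// group_expectationE// (right_coset_eq tg).
by rewrite !cutoff_out.
Qed.

(** On a finitely supported vector only finitely many cosets contribute, and the
    quadratic form is a finite sum of values of the form of [x].  The general
    case follows by approximation. *)
Lemma group_expectation_positive x : bounded_ops x -> positive_op x ->
  positive_op (group_expectation x).
Proof.
move=> xb x0 u; have Eb := group_expectation_bounded xb.
have fin (s : seq G) : 0 <= inner (group_expectation x (cutoff [set` s] u))
  (cutoff [set` s] u).
  set v := cutoff _ _; pose rs := undup [seq coset_repr t | t <- s].
  pose F r : set G := [set g | coset_repr g = r].
  have -> : group_expectation x v = \sum_(r <- rs) cutoff (F r) (x (cutoff (F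
    r) v)).
    apply: l2_ext => t; rewrite l2_sum group_expectationE// -coset_fiber.
    have [trs|trs] := boolP (coset_repr t \in rs).
      rewrite (bigD1_seq (coset_repr t)) ?undup_uniq// cutoff_in//.
      rewrite big1 ?[RHS]addr0// => r rt; rewrite cutoff_out//.
      by move=> tr; rewrite /F /= in tr; rewrite tr eqxx in rt.
    rewrite (_ : cutoff _ v = 0); last first.
      apply: l2_ext => g; have [gt|gt] := pselect (F (coset_repr t) g);
        last by rewrite cutoff_out.
      rewrite cutoff_in// /v cutoff_out// => gs; move/negP: trs; apply.
      by rewrite mem_undup -gt; exact: map_f.
    rewrite (op_lin0 xb.1) l20 big1_seq// => r /andP[_ rrs];
      rewrite cutoff_out//.
    by move=> tr; move: trs; rewrite tr rrs.
  rewrite (big_morph (fun w => inner w v) (fun w w' => innerDl w w' v) (inner0l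
    v)).
  by apply: sumr_ge0 => r _; rewrite inner_cutoff; exact: x0.
apply: complex_ge0_closed => e e0; have [M M0 EM] := bounded_bound Eb.
have Kp : 0 < M * norm2 u + M * norm2 u + 1.
  by rewrite ltr_wpDl// addr_ge0// mulr_ge0// norm2_ge0.
have [s us us'] := finite_support_dense u (divr_gt0 e0 Kp).
exists (inner (group_expectation x (cutoff [set` s] u)) (cutoff [set` s] u)) =>
  //.
move: us'; set v := cutoff _ u => uv.
rewrite (_ : _ - _ = inner (group_expectation x (u - v)) u + inner
  (group_expectation x v) (u - v)).
  apply: le_trans (le_normcD _ _) _.
  apply: (@le_trans _ _ ((M * norm2 u + M * norm2 u + 1) * norm2 (u - v))).
    rewrite mulrDl mul1r -[X in X <= _]addr0 lerD ?norm2_ge0// mulrDl lerD//.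
      apply: le_trans (cauchy_schwarz _ _) _.
      by rewrite mulrAC ler_wpM2r ?norm2_ge0.
    apply: le_trans (cauchy_schwarz _ _) _; rewrite ler_wpM2r ?norm2_ge0//.
    by apply: le_trans (EM v) _; rewrite ler_wpM2l// norm2_cutoff.
  by rewrite mulrC -ler_pdivlMr.
by rewrite (op_linB Eb.1) innerBl innerBr addrA subrK.
Qed.

End Subgroup.

Theorem group_expectation_cond_exp J K : subgroup_set J -> subgroup_set K -> K
  `<=` J ->
  cond_exp canonical_trace (group_vN R J) (group_vN R K) (group_expectation K).
Proof.
move=> JG KG KJ; have Jb x : group_vN R J x -> bounded_ops x /\ right_invariant
  x.
  by move=> /(group_vNP JG)[].
split=> [|c x y /Jb[xb _] /Jb[yb _]|a x b Ka /Jb[xb _] Kb|x /Jb[xb _]|x /Jb[xb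
  _]].
- split=> [x /Jb[xb xR]|x]; first exact: group_expectation_group_vN.
  exact: group_expectation_fix.
- exact: group_expectation_linear.
- exact: group_expectation_bimodule.
- exact: group_expectation_positive.
- by rewrite !trace_coef coef_group_expectation// mem_set//; have [] := KG.
Qed.

(** Both compositions multiply coefficient functions by an indicator. *)
Theorem group_vN_commuting_square J K1 K2 K : subgroup_set J ->
  subgroup_set K1 -> subgroup_set K2 -> subgroup_set K ->
  K1 `<=` J -> K2 `<=` J -> K `<=` K1 -> K `<=` K2 -> K1 `&` K2 `<=` K ->
  commuting_square canonical_trace
    (group_vN R K2) (group_vN R J) (group_vN R K) (group_vN R K1).
Proof.
move=> JG K1G K2G KG K1J K2J KK1 KK2 K12.
have mono (A B : set G) : subgroup_set A -> subgroup_set B -> A `<=` B ->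
    group_vN R A `<=` group_vN R B.
  move=> AG BG AB x /(group_vNP AG)[xb xR xA]; apply/(group_vNP BG); split=> //.
  by move=> t Bt; apply: xA => /AB.
split; first by split; exact: group_vN_von_neumann.
  by split; exact: mono.
exists (group_expectation K1), (group_expectation K2), (group_expectation K);
  split.
- exact: group_expectation_cond_exp.
- exact: group_expectation_cond_exp.
- by apply: group_expectation_cond_exp => //; exact: subset_trans K2J.
move=> x /(group_vNP JG)[xb xR _].
have E2b := group_expectation_bounded K2G xb.
have E2R := group_expectation_right_invariant K2G xb xR.
apply: coef_inj => [||||t].
- exact: group_expectation_bounded.
- exact: group_expectation_bounded.
- exact: group_expectation_right_invariant.
- exact: group_expectation_right_invariant.
rewrite !coef_group_expectation//.
have [Kt|Kt] := pselect (K t).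
  by rewrite !mem_set//; [exact: KK2|exact: KK1].
rewrite (memNset Kt); have [K1t|K1t] := pselect (K1 t); last by rewrite memNset.
rewrite mem_set//; have [K2t|K2t] := pselect (K2 t); last by rewrite memNset.
by exfalso; apply: Kt; exact: K12.
Qed.

End ConditionalExpectation.

(** * Completeness and strong operator limits *)

Section Convergence.
Variables (R : realType) (G : groupType).
Local Notation C := R[i].
Local Notation H := (l2 R G).
Local Notation op := (H -> H).
Implicit Types (u v w : H) (a c : C) (s t g r : G) (S T x y : op) (J K : set G).

Lemma le_halves (a b e : R) : a <= e / 2 -> b <= e / 2 -> a + b <= e.
Proof. by move=> ae be; rewrite [e]splitr lerD. Qed.

Lemma real_cauchy_limit (f : nat -> R) :
  (forall e, 0 < e -> exists N, forall m n, (N <= m)%N -> (N <= n)%N ->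
    `|f m - f n| <= e) ->
  exists l, forall e, 0 < e -> exists N, forall n, (N <= n)%N -> `|f n - l| <=
    e.
Proof.
move=> fc; have cf : cvg (f @ \oo).
  apply/cauchy_cvgP/cauchy_exP => e e0;
    have e20 : 0 < e / 2 by rewrite divr_gt0.
  have [N fN] := fc _ e20; exists (f N), N => // n /= Nn.
  rewrite /ball /=; apply: le_lt_trans (fN _ _ (leqnn N) Nn) _.
  by rewrite ltr_pdivrMr// ltr_pMr// ltr1n.
exists (lim (f @ \oo)) => e e0.
have [N _ fN] := (cvgrPdist_le _ _).1 cf e e0.
by exists N => n Nn; rewrite distrC; exact: fN.
Qed.

Lemma complex_cauchy_limit (f : nat -> C) :
  (forall e, 0 < e -> exists N, forall m n, (N <= m)%N -> (N <= n)%N ->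
    Normc.normc (f m - f n) <= e) ->
  exists l, forall e, 0 < e -> exists N, forall n, (N <= n)%N ->
    Normc.normc (f n - l) <= e.
Proof.
move=> fc.
have ReB (z w : C) : complex.Re (z - w) = complex.Re z - complex.Re w.
  by case: z => p q; case: w.
have ImB (z w : C) : complex.Im (z - w) = complex.Im z - complex.Im w.
  by case: z => p q; case: w.
have [|l1 l1P] := @real_cauchy_limit (fun n => complex.Re (f n)).
  move=> e /fc[N fN]; exists N => m n Nm Nn; rewrite -ReB.
  exact: le_trans (normc_Re _) (fN _ _ Nm Nn).
have [|l2 l2P] := @real_cauchy_limit (fun n => complex.Im (f n)).
  move=> e /fc[N fN]; exists N => m n Nm Nn; rewrite -ImB.
  exact: le_trans (normc_Im _) (fN _ _ Nm Nn).
exists (l1 +i* l2) => e e0; have e20 : 0 < e / 2 by rewrite divr_gt0.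
have [N1 N1P] := l1P _ e20; have [N2 N2P] := l2P _ e20.
exists (maxn N1 N2) => n; rewrite geq_max => /andP[/N1P n1 /N2P n2].
apply: le_trans (normc_le_ReIm _) _; rewrite ReB ImB /=; lra.
Qed.

Lemma norm2_finite_vector (r : seq G) (f : G -> C) (d : R) :
  (forall t, t \in r -> Normc.normc (f t) <= d) ->
  norm2 (finite_vector r f) <= (size r)%:R * d.
Proof.
elim: r => [_|t r IH fd]; first by rewrite /finite_vector big_nil norm20 mul0r.
rewrite /finite_vector big_cons; apply: le_trans (norm2D _ _) _.
rewrite -[size _]/(size r).+1 -natr1 mulrDl mul1r addrC lerD//.
  by apply: IH => q qr; apply: fd; rewrite inE qr orbT.
by rewrite norm2Z norm2_delta mulr1; apply: fd; rewrite mem_head.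
Qed.

Definition l2_cvg (un : nat -> H) u : Prop :=
  forall e, 0 < e -> exists N, forall n, (N <= n)%N -> norm2 (un n - u) <= e.

Definition l2_cauchy (un : nat -> H) : Prop :=
  forall e, 0 < e -> exists N, forall m n, (N <= m)%N -> (N <= n)%N ->
    norm2 (un m - un n) <= e.

(** The coordinates converge.  On a finite set of coordinates the limit can be
    replaced by a late member of the sequence, which bounds all finite partial
    sums of the squared distance. *)
Lemma l2_complete (un : nat -> H) : l2_cauchy un -> exists u, l2_cvg un u.
Proof.
move=> uc.
have /choice[U UP] : forall t, exists l, forall e, 0 < e -> exists N, forall n,
    (N <= n)%N -> Normc.normc (un n t - l) <= e.
  move=> t; apply: complex_cauchy_limit => e /uc[N uN]; exists N => m n Nm Nn.
  by rewrite -l2B; exact: le_trans (normc_le_norm2 _ _) (uN _ _ Nm Nn).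
have close (r : seq G) d N : 0 < d -> exists2 m, (N <= m)%N &
    forall t, t \in r -> Normc.normc (un m t - U t) <= d.
  move=> d0; suff [m mP] : exists m, forall n, (m <= n)%N ->
      forall t, t \in r -> Normc.normc (un n t - U t) <= d.
    by exists (maxn N m); [exact: leq_maxl|apply: mP; exact: leq_maxr].
  elim: r => [|t r [m mP]]; first by exists 0%N.
  have [k kP] := UP t d d0; exists (maxn k m) => n.
  by rewrite geq_max => /andP[kn mn] q; rewrite inE => /predU1P[->|/mP];
    [exact: kP|exact].
have bound e N : 0 < e -> (forall m n, (N <= m)%N -> (N <= n)%N ->
    norm2 (un m - un n) <= e) -> forall n, (N <= n)%N ->
    (nsum (fun t => modsq (un n t - U t)%R) <= ((e + e) ^+ 2)%:E)%E.
  move=> e0 uN n Nn; apply: nsum_le_seq => r ur; rewrite lee_fin.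
  have d0 : 0 < e / (size r).+1%:R by rewrite divr_gt0// ltr0n.
  have [m Nm mP] := close r _ N d0.
  set V := finite_vector r (fun t => un n t - U t).
  (* compare un n with the limit through a member un m chosen after r *)
  have VE : V = cutoff [set` r] (un n - un m) +
      finite_vector r (fun t => un m t - U t).
    have -> : cutoff [set` r] (un n - un m) =
        finite_vector r (fun t => un n t - un m t).
      apply: l2_ext => t; have [tr|tr] := boolP (t \in r).
        by rewrite cutoff_in// finite_vector_in.
      rewrite cutoff_out; last exact/negP.
      rewrite /finite_vector l2_sum big1_seq// => q /andP[_ qr].
      by rewrite l2Z delta_neq ?mulr0// => tq; rewrite tq qr in tr.
    rewrite /V /finite_vector -big_split; apply: eq_bigr => t _ /=.
    by rewrite -scalerDl addrA subrK.
  have VN : norm2 V <= e + e.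
    rewrite VE; apply: le_trans (norm2D _ _) _; rewrite lerD//.
      exact: le_trans (norm2_cutoff _ _) (uN _ _ Nn Nm).
    apply: le_trans (norm2_finite_vector mP) _.
    rewrite mulrCA ger_pMr// ler_pdivrMr ?ltr0n// mul1r ler_nat leqnSn//.
  apply: (@le_trans _ _ (norm2 V ^+ 2)); last first.
    by rewrite ler_pXn2r ?nnegrE ?norm2_ge0// addr_ge0// ltW.
  rewrite -lee_fin norm2_sq (eq_big_seq (fun t => modsq (V t))).
    exact: nsum_ge_seq.
  by move=> t tr; rewrite finite_vector_in.
have [N0 N0P] := uc 1 ltr01.
have Ds : (fun t => un N0 t - U t) \in @sqsummable_pred R G.
  apply: sqsummableP; apply: le_lt_trans (bound 1 N0 ltr01 N0P N0 (leqnn _)) _.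
  exact: ltry.
exists (un N0 - L2 Ds) => e e0; have e20 : 0 < e / 2 by rewrite divr_gt0.
have [N NP] := uc _ e20; exists N => n Nn.
apply: nsum_norm2_le; first exact: ltW.
rewrite [X in X ^+ 2](splitr e); apply: le_trans (bound _ N e20 NP n Nn).
by apply: le_nsum => t; rewrite !l2B -[L2 Ds t]/(un N0 t - U t) subKr.
Qed.

Lemma l2_cvg_unique (un : nat -> H) u v : l2_cvg un u -> l2_cvg un v -> u = v.
Proof.
move=> uu uv; apply: norm2_closed => e e0;
  have e20 : 0 < e / 2 by rewrite divr_gt0.
have [N NP] := uu _ e20; have [M MP] := uv _ e20.
apply: le_trans (norm2_triangle (un (maxn N M)) _ _) _.
apply: le_halves; last by apply: MP; exact: leq_maxr.
by rewrite norm2_distC; apply: NP; exact: leq_maxl.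
Qed.

Lemma l2_cvg_eventually (un vn : nat -> H) u N :
  (forall n, (N <= n)%N -> un n = vn n) -> l2_cvg un u -> l2_cvg vn u.
Proof.
move=> uv uu e /uu[M MP]; exists (maxn N M) => n.
by rewrite geq_max => /andP[Nn Mn]; rewrite -uv// MP.
Qed.

Lemma l2_cvg_cauchy (un : nat -> H) u : l2_cvg un u -> l2_cauchy un.
Proof.
move=> uu e e0; have e20 : 0 < e / 2 by rewrite divr_gt0.
have [N NP] := uu _ e20; exists N => m n Nm Nn.
apply: le_trans (norm2_triangle u _ _) _.
by apply: le_halves; [exact: NP|rewrite norm2_distC; exact: NP].
Qed.

Lemma l2_cvg_combination a (un vn : nat -> H) u v :
  l2_cvg un u -> l2_cvg vn v -> l2_cvg (fun n => a *: un n + vn n) (a *: u + v).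
Proof.
move=> uu vv e e0; have e20 : 0 < e / 2 by rewrite divr_gt0.
have ap : 0 < Normc.normc a + 1 by rewrite ltr_wpDl// normc_ge0.
have [N NP] := uu _ (divr_gt0 e20 ap); have [M MP] := vv _ e20.
exists (maxn N M) => n; rewrite geq_max => /andP[Nn Mn].
rewrite opprD addrACA -scalerBr; apply: le_trans (norm2D _ _) _.
apply: le_halves; last exact: MP.
rewrite norm2Z.
apply: (@le_trans _ _ ((Normc.normc a + 1) * norm2 (un n - u))).
  by rewrite ler_wpM2r ?norm2_ge0// lerDl.
by rewrite mulrC -ler_pdivlMr// NP.
Qed.

Lemma l2_cvg_op T (un : nat -> H) u : bounded_ops T ->
  l2_cvg un u -> l2_cvg (fun n => T (un n)) (T u).
Proof.
move=> Tb uu e e0; have [M M0 TM] := bounded_bound Tb.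
have Mp : 0 < M + 1 by rewrite ltr_wpDl.
have [N NP] := uu _ (divr_gt0 e0 Mp); exists N => n /NP uN.
rewrite -(op_linB Tb.1); apply: le_trans (TM _) _.
apply: (@le_trans _ _ ((M + 1) * norm2 (un n - u))).
  by rewrite ler_wpM2r ?norm2_ge0// lerDl.
by rewrite mulrC -ler_pdivlMr.
Qed.

Lemma l2_cvg_coord (un : nat -> H) u t (c : C) N : l2_cvg un u ->
  (forall n, (N <= n)%N -> un n t = c) -> u t = c.
Proof.
move=> uu uc; apply/eqP; rewrite -subr_eq0; apply/eqP/Normc.eq0_normc/eqP.
rewrite eq_le normc_ge0 andbT; apply/ler_addgt0Pl => e /uu[M MP]; rewrite addr0.
have := MP (maxn N M) (leq_maxr _ _); apply: le_trans.
rewrite norm2_distC -(uc (maxn N M) (leq_maxl _ _)) -l2B.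
exact: normc_le_norm2.
Qed.

Lemma norm2_l2_cvg (un : nat -> H) u (M : R) : l2_cvg un u ->
  (forall n, norm2 (un n) <= M) -> norm2 u <= M.
Proof.
move=> uu uM; apply/ler_addgt0Pl => e /uu[N NP].
rewrite -[u](subrK (un N)); apply: le_trans (norm2D _ _) _.
by apply: lerD; [rewrite norm2_distC; exact: NP|exact: uM].
Qed.

Lemma sot_cvgP (Tn : nat -> op) T :
  sot_cvg Tn T <-> forall u, l2_cvg (fun n => Tn n u) (T u).
Proof.
split=> [TT u e e0|TT u].
  have [N _ NP] := (cvgr0Pnorm_le _).1 (TT u) e e0.
  by exists N => n /NP; rewrite ger0_norm// norm2_ge0.
apply/cvgr0Pnorm_le => e /(TT u)[N NP]; exists N => // n /= /NP.
by rewrite ger0_norm// norm2_ge0.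
Qed.

Lemma sot_limE (Tn : nat -> op) T : sot_cvg Tn T -> sot_lim Tn = T.
Proof.
move=> TT; rewrite /sot_lim; case: xgetP => [S _ /= TS|/(_ T)//].
apply/funext => u; apply: l2_cvg_unique ((sot_cvgP _ _).1 TS u) _.
exact: (sot_cvgP _ _).1.
Qed.

Definition uniformly_bounded (Tn : nat -> op) (M : R) : Prop :=
  (forall n, bounded_ops (Tn n)) /\ forall n u, norm2 (Tn n u) <= M * norm2 u.

(** Uniform boundedness spreads the Cauchy property from the point masses to all
    vectors. *)
Lemma sot_exists (Tn : nat -> op) (M : R) : 0 <= M -> uniformly_bounded Tn M ->
  (forall t, l2_cauchy (fun n => Tn n (delta R t))) ->
  exists2 T, bounded_ops T & sot_cvg Tn T.
Proof.
move=> M0 [Tb TM] Td.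
have /choice[T TP] : forall u, exists v, l2_cvg (fun n => Tn n u) v.
  move=> u; apply: l2_complete; move: u; apply: l2_ind => // [a u v uc vc|u uc].
    have [u' uu'] := l2_complete uc; have [v' vv'] := l2_complete vc.
    apply: l2_cvg_cauchy (a *: u' + v') _.
    apply: (@l2_cvg_eventually _ _ _ 0%N _ (l2_cvg_combination a uu' vv')) => n
      _.
    by rewrite (Tb n).1.
  move=> e e0; have M1 : 0 < M + M + 1 by rewrite ltr_wpDl// addr_ge0.
  have e20 : 0 < e / 2 by rewrite divr_gt0.
  have [v vc uv] := uc _ (divr_gt0 e20 M1); have [N NP] := vc _ e20.
  exists N => m n Nm Nn.
  rewrite (_ : _ - _ = Tn m (u - v) - Tn n (u - v) + (Tn m v - Tn n v));
    last first.
    rewrite (op_linB (Tb m).1) (op_linB (Tb n).1); apply: l2_ext => t.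
    by rewrite l2D !l2B; ring.
  apply: le_trans (norm2D _ _) _; apply: le_halves; last exact: NP.
  apply: le_trans (norm2D _ _) _; rewrite norm2N.
  apply: (@le_trans _ _ ((M + M + 1) * norm2 (u - v))).
    rewrite !mulrDl mul1r -[leLHS]addr0 lerD ?norm2_ge0// lerD ?TM//.
  by rewrite mulrC -ler_pdivlMr.
exists T; last exact/sot_cvgP.
split=> [a u v|]; last first.
  by exists M => u; apply: norm2_l2_cvg (TP u) _ => n; exact: TM.
apply: l2_cvg_unique (TP _) _.
apply: (@l2_cvg_eventually _ _ _ 0%N _ (l2_cvg_combination a (TP u) (TP v))) =>
  n _.
by rewrite (Tb n).1.
Qed.

Lemma sot_comp (Sn Tn : nat -> op) S T (M : R) : 0 <= M ->
  uniformly_bounded Sn M -> sot_cvg Sn S -> sot_cvg Tn T ->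
  sot_cvg (fun n => Sn n \o Tn n) (S \o T).
Proof.
move=> M0 [Sb SM] /sot_cvgP SS /sot_cvgP TT; apply/sot_cvgP => u e e0.
have e20 : 0 < e / 2 by rewrite divr_gt0.
have M1 : 0 < M + 1 by rewrite ltr_wpDl.
have [N NP] := SS (T u) _ e20; have [K KP] := TT u _ (divr_gt0 e20 M1).
exists (maxn N K) => n; rewrite geq_max => /andP[Nn Kn] /=.
apply: le_trans (norm2_triangle (Sn n (T u)) _ _) _.
apply: le_halves; last exact: NP.
rewrite -(op_linB (Sb n).1); apply: le_trans (SM _ _) _.
apply: (@le_trans _ _ ((M + 1) * norm2 (Tn n u - T u))).
  by rewrite ler_wpM2r ?norm2_ge0// lerDl.
by rewrite mulrC -ler_pdivlMr// KP.
Qed.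

Lemma sot_right_invariant (Tn : nat -> op) T :
  (forall n, right_invariant (Tn n)) -> sot_cvg Tn T -> right_invariant T.
Proof.
move=> Tr /sot_cvgP TT t; apply/funext => u.
apply: l2_cvg_unique (TT _) _.
apply: (@l2_cvg_eventually _ _ _ 0%N _ (l2_cvg_op (right_regular_bounded R t)
  (TT u))) => n _.
by rewrite -[LHS]/((right_regular t \o Tn n) u) -Tr.
Qed.

End Convergence.

(** * Conjugation by group elements *)

Section GroupAlgebra.
Variables (R : realType) (G : groupType).
Local Notation C := R[i].
Local Notation H := (l2 R G).
Local Notation op := (H -> H).
Local Notation L := (@left_regular R G).
Local Notation Rr := (@right_regular R G).
Implicit Types (u v : H) (c : C) (s t g r : G) (S T x y : op) (J K : set G).

Lemma subgroup_setT : subgroup_set [set: G]. Proof. by []. Qed.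

Lemma group_vN_topP x :
  group_vN R [set: G] x <-> bounded_ops x /\ right_invariant x.
Proof.
split=> [/(group_vNP subgroup_setT)[]//|[xb xR]].
by apply/(group_vNP subgroup_setT); split=> // t [].
Qed.

Lemma group_vN_mono J K : subgroup_set J -> subgroup_set K -> J `<=` K ->
  group_vN R J `<=` group_vN R K.
Proof.
move=> JG KG JK x /(group_vNP JG)[xb xR xJ]; apply/(group_vNP KG); split=> //.
by move=> t Kt; apply: xJ => /JK.
Qed.

Lemma vN_left_subgroup (M : set op) : von_neumann M ->
  subgroup_set [set s | M (L s)].
Proof.
move=> vM; split=> [|s t Ms Mt|s Ms] /=; first by rewrite left_regular1;
  exact: vN_id.
  by rewrite left_regularM; exact: vN_comp.
by rewrite -adjoint_left_regular; exact: vN_adjoint.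
Qed.

(** The group elements whose translation lies in a given von Neumann algebra
    form a subgroup, so translations by generators suffice. *)
Lemma vN_generated_group (A : set op) (B : set G) :
  A `<=` group_vN R (generated_subgroup B) -> (forall s, B s -> A (L s)) ->
  vN_generated A = group_vN R (generated_subgroup B).
Proof.
move=> AB BA; have BG := generated_subgroup_group B.
apply/seteqP; split; first by apply: smallest_sub => //;
  exact: group_vN_von_neumann.
move=> x xB M [vM AM]; apply: xB; split=> // _ [s Bs <-].
suff /(_ s Bs) : generated_subgroup B `<=` [set s | M (L s)] by [].
apply: generated_subgroup_min; first exact: vN_left_subgroup.
by move=> t Bt; apply: AM; exact: BA.
Qed.

Lemma Ad_leftE s x : Ad_left s x = L s \o x \o L s^-1%g.
Proof. by rewrite /Ad_left /Ad adjoint_left_regular. Qed.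

Lemma Ad_left_bounded s x : bounded_ops x -> bounded_ops (Ad_left s x).
Proof.
move=> xb; rewrite Ad_leftE; apply: bounded_comp;
  last exact: left_regular_bounded.
by apply: bounded_comp xb; exact: left_regular_bounded.
Qed.

Lemma Ad_left_right_invariant s x : right_invariant x ->
  right_invariant (Ad_left s x).
Proof.
move=> xR t; have LR q u : L q (Rr t u) = Rr t (L q u).
  by have := congr1 (fun y : op => y u) (left_right_commute R q t).
have xRE u : x (Rr t u) = Rr t (x u) by have := congr1 (fun y : op => y u) (xR
  t).
by rewrite Ad_leftE; apply/funext => u; rewrite /comp LR xRE LR.
Qed.

Lemma Ad_left_group_vN s x :
  group_vN R [set: G] x -> group_vN R [set: G] (Ad_left s x).
Proof.
move=> /group_vN_topP[xb xR]; apply/group_vN_topP; split.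
  exact: Ad_left_bounded.
exact: Ad_left_right_invariant.
Qed.

Lemma Ad_leftM s t x : Ad_left (s * t)%g x = Ad_left s (Ad_left t x).
Proof. by rewrite !Ad_leftE invgM !left_regularM. Qed.

Lemma Ad_left1 x : Ad_left 1%g x = x.
Proof. by rewrite Ad_leftE invg1 left_regular1. Qed.

Lemma Ad_left_delta s x : right_invariant x ->
  Ad_left s x (delta R 1%g) = L s (Rr s (x (delta R 1%g))).
Proof.
move=> xR; rewrite Ad_leftE /comp left_regular_delta mulg1.
rewrite -[Rr s (x _)]/((Rr s \o x) _) -xR /comp right_regular_delta.
by rewrite mul1g.
Qed.

Lemma Ad_left_automorphism s :
  automorphism canonical_trace (group_vN R [set: G]) (Ad_left s).
Proof.
have vN := group_vN_von_neumann R subgroup_setT.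
have b x : group_vN R [set: G] x -> bounded_ops x by move=> /group_vN_topP[].
have inv x : Ad_left s^-1%g (Ad_left s x) = x.
  by rewrite -Ad_leftM mulVg Ad_left1.
split; last first.
  apply/seteqP; split=> [_ [x xG <-]|x xG]; first exact: Ad_left_group_vN.
  exists (Ad_left s^-1%g x); first exact: Ad_left_group_vN.
  by rewrite -Ad_leftM mulgV Ad_left1.
split; last first.
  rewrite Ad_leftE -[_ \o idfun]/(L s) -left_regularM mulgV.
  exact: left_regular1.
split; [split| |].
- by move=> x; exact: Ad_left_group_vN.
- move=> c x y _ _; rewrite !Ad_leftE; apply/funext => u.
  rewrite -[LHS]/(L s (c *: x (L s^-1%g u) + y (L s^-1%g u))).
  by rewrite left_regular_linear.
- move=> x y _ _; rewrite !Ad_leftE; apply/funext => u /=.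
  congr (L s (x _)); rewrite -[RHS]/((L s^-1%g \o L s) (y (L s^-1%g u))).
  by rewrite -left_regularM mulVg left_regular1.
- move=> x /b xb; rewrite !Ad_leftE.
  have sb := left_regular_bounded R s;
    have sVb := left_regular_bounded R s^-1%g.
  rewrite (adjoint_comp (bounded_comp sb xb) sVb) (adjoint_comp sb xb).
  by rewrite !adjoint_left_regular invgK.
- by move=> x y _ _ /(congr1 (Ad_left s^-1%g)); rewrite !inv.
- move=> x /group_vN_topP[xb xR]; rewrite !trace_coef coef_Ad_left//.
  by rewrite mulg1 mulVg.
Qed.

(** Otherwise the squared norm of [u] would exceed every multiple of the squared
    modulus of [c]. *)
Lemma level_set_finite u c : c != 0 -> finite_set [set g | u g = c].
Proof.
move=> c0; apply: contrapT => /infinite_set_fset cinf.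
have cp : 0 < modsq c.
  rewrite /modsq exprn_gt0// lt_neqAle normc_ge0 andbT eq_sym.
  by apply: contra_neq c0; exact: Normc.eq0_normc.
have [B BA Bn] := cinf (Num.bound (norm2 u ^+ 2 / modsq c)).
have := nsum_ge_seq (fun t => modsq (u t)) (finmap.fset_uniq B).
rewrite -norm2_sq lee_fin (eq_big_seq (fun=> modsq c)); last first.
  by move=> t tB; rewrite (BA t tB).
rewrite big_const_seq count_predT iter_addr_0 -mulr_natl.
rewrite -ler_pdivlMr//; apply/negP; rewrite -ltNge.
apply: (@lt_le_trans _ _ (Num.bound (norm2 u ^+ 2 / modsq c))%:R).
  by apply: archi_boundP; rewrite divr_ge0 ?sqr_ge0.
by rewrite ler_nat.
Qed.

(** The trace of [x \o y] is the inner product of the coefficient functions of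
    [y] and of the adjoint of [x], whose supports meet only in 1. *)
Lemma trace_comp_independent J K x y :
  subgroup_set J -> subgroup_set K -> (forall s, J s -> K s -> s = 1%g) ->
  group_vN R J x -> group_vN R K y ->
  canonical_trace (x \o y) = canonical_trace x * canonical_trace y.
Proof.
move=> JG KG JK xJ yK.
have [xb xR _] := (group_vNP JG x).1 xJ.
have [_ _ xs] := (group_vNP JG _).1 (vN_adjoint (group_vN_von_neumann R JG) xJ).
have [yb yR ys] := (group_vNP KG y).1 yK.
rewrite {1}/canonical_trace /comp (adjointP xb).2.
have z g : g <> 1%g -> coef y g * (coef (adjoint x) g)^*%C = 0.
  move=> g1; have [Jg|Jg] := pselect (J g); last by rewrite xs// conjc0 mulr0.
  by have [Kg|Kg] := pselect (K g); [case: g1; exact: JK|rewrite ys// mul0r].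
rewrite !trace_coef mulrC -[coef x 1%g](conjcK) -[in RHS](invg1 G)
  -coef_adjoint//.
rewrite invg1.
rewrite /inner /csum !(@rsum1 _ _ _ 1%g) => [|g /z|g /z]; last 2 first.
  by rewrite /coef => ->.
  by rewrite /coef => ->.
by rewrite -!/(coef _ _); case: (_ * _).
Qed.

Section AdLimit.
Variables (w : nat -> G) (th : G -> G) (x : op).
Hypothesis xb : bounded_ops x.
Hypothesis xR : right_invariant x.
Hypothesis wth : forall t, coef x t != 0 ->
  exists N, forall n, (N <= n)%N -> (w n * t * (w n)^-1)%g = th t.
Let f : H := x (delta R 1%g).
Let shiftn n u : H := L (w n) (Rr (w n) u).

Let shiftn_linear n : linear (shiftn n).
Proof.
by move=> c u v; rewrite /shiftn right_regular_linear left_regular_linear.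
Qed.

Let norm2_shiftn n u : norm2 (shiftn n u) = norm2 u.
Proof. by rewrite /shiftn norm2_left_regular norm2_right_regular. Qed.

Let off_image s := forall t, coef x t != 0 -> th t != s.

Let shiftn_finite (q : seq G) : uniq q -> exists N v,
  (forall n, (N <= n)%N -> shiftn n (cutoff [set` q] f) = v) /\
  forall s, off_image s -> v s = 0.
Proof.
elim: q => [_|t q IH /= /andP[tq uq]].
  by exists 0%N, 0; split=> // n _; rewrite cutoff0 (op_lin0 (shiftn_linear n)).
have [N [v [Nv v0]]] := IH uq; have [ft0|ft0] := eqVneq (coef x t) 0.
  exists N, v; split=> // n Nn; rewrite cutoff_cons// -[f t]/(coef x t) ft0.
  by rewrite scale0r add0r Nv.
have [M Mt] := wth ft0; exists (maxn N M), (coef x t *: delta R (th t) + v).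
split=> [n|s soff].
  rewrite geq_max => /andP[Nn Mn]; rewrite cutoff_cons// shiftn_linear Nv//.
  by rewrite /shiftn right_regular_delta left_regular_delta mulgA Mt.
rewrite l2D l2Z v0// delta_neq ?mulr0 ?addr0// => st.
by have := soff t ft0; rewrite st eqxx.
Qed.

Let shiftn_cauchy : l2_cauchy (fun n => shiftn n f).
Proof.
move=> e e0; have e20 : 0 < e / 2 by rewrite divr_gt0.
have [q uq fq] := finite_support_dense f e20.
have [N [v [Nv _]]] := shiftn_finite uq; exists N => m n Nm Nn.
apply: le_trans (norm2_triangle v _ _) _; apply: le_halves.
  by rewrite -(Nv m Nm) -(op_linB (shiftn_linear m)) norm2_shiftn.
by rewrite norm2_distC -(Nv n Nn) -(op_linB (shiftn_linear n)) norm2_shiftn.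
Qed.

Lemma Ad_left_bound (M : R) : 0 <= M ->
  (forall u, norm2 (x u) <= M * norm2 u) ->
  uniformly_bounded (fun n => Ad_left (w n) x) M.
Proof.
move=> M0 xM; split=> [n|n u]; first exact: Ad_left_bounded.
by rewrite Ad_leftE /= norm2_left_regular; apply: le_trans (xM _) _;
  rewrite norm2_left_regular.
Qed.

(** Up to a small error [x delta_1] has finite support, and then its image under
    the conjugations is eventually constant.  The limit carries the coefficient
    of [x] at [t] to [th t]. *)
Lemma Ad_limit : exists y,
  [/\ bounded_ops y, right_invariant y, sot_cvg (fun n => Ad_left (w n) x) y,
      forall t, coef x t != 0 -> coef y (th t) = coef x t &
      forall s, (forall t, coef x t != 0 -> th t != s) -> coef y s = 0].
Proof.
have [M M0 xM] := bounded_bound xb.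
have AdR n : right_invariant (Ad_left (w n) x) by exact:
  Ad_left_right_invariant.
have Ad1 n : Ad_left (w n) x (delta R 1%g) = shiftn n f by exact: Ad_left_delta.
have [|y yb yc] := sot_exists M0 (Ad_left_bound M0 xM).
  move=> t e e0; have [N NP] := shiftn_cauchy e0; exists N => m n Nm Nn.
  have E k : Ad_left (w k) x (delta R t) = Rr t^-1%g (shiftn k f).
    rewrite -Ad1 -[RHS]/((Rr t^-1%g \o Ad_left (w k) x) _) -AdR /comp.
    by rewrite right_regular_delta invgK mul1g.
  rewrite !E -(op_linB (right_regular_linear t^-1%g)) norm2_right_regular.
  exact: NP.
have y1 : l2_cvg (fun n => shiftn n f) (y (delta R 1%g)).
  have := (sot_cvgP _ _).1 yc (delta R 1%g).
  by apply: (@l2_cvg_eventually _ _ _ _ _ 0%N) => n _; exact: Ad1.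
exists y; split=> //; first exact: sot_right_invariant yc.
  move=> t ft0; have [N NP] := wth ft0;
    apply: (@l2_cvg_coord R G _ _ _ _ N y1) => n.
  move=> /NP <-; rewrite /shiftn left_regularE right_regularE.
  by rewrite !mulgA mulVg mul1g mulgVK.
move=> s soff; apply/Normc.eq0_normc/eqP.
rewrite eq_le normc_ge0 andbT; apply/ler_addgt0Pl => e e0; rewrite addr0.
have e20 : 0 < e / 2 by rewrite divr_gt0.
have [q uq fq] := finite_support_dense f e20.
have [N [v [Nv v0]]] := shiftn_finite uq; have [K KP] := y1 _ e20.
pose n := maxn N K.
have := normc_le_norm2 (y (delta R 1%g) - v) s.
rewrite l2B v0// subr0 => /le_trans; apply.
apply: le_trans (norm2_triangle (shiftn n f) _ _) _; apply: le_halves.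
  by rewrite norm2_distC; apply: KP; exact: leq_maxr.
rewrite -(Nv n (leq_maxl _ _)) -(op_linB (shiftn_linear n)) norm2_shiftn.
exact: fq.
Qed.

End AdLimit.

End GroupAlgebra.

(** * The shift endomorphism *)

Section BraidShift.
Variable R : realType.
Local Notation H := (l2 R braid).
Local Notation op := (H -> H).
Local Notation L := (@left_regular R braid).
Implicit Types (x y : op) (t s : braid) (K : set braid).

Lemma LBooP x : LBoo R x <-> bounded_ops x /\ right_invariant x.
Proof. exact: group_vN_topP. Qed.

Lemma ascending_conj_eventually t :
  exists N, forall n, (N <= n)%N ->
    (ascending n * t * (ascending n)^-1)%g = sh t.
Proof.
have [N tN] := braid_sub_exists t; exists N => n Nn.
by apply: ascending_conj; exact: braid_sub_leq tN.
Qed.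

Lemma LBoo_ext x y : LBoo R x -> LBoo R y -> coef x =1 coef y -> x = y.
Proof. by move=> /LBooP[xb xR] /LBooP[yb yR]; exact: coef_inj. Qed.

Lemma LBoo_von_neumann : von_neumann (LBoo R).
Proof. exact: group_vN_von_neumann (subgroup_setT braid). Qed.

(** The characterization of the shift from which all its properties are derived;
    the third and fourth clauses determine [a x]. *)
Definition shift_spec (a : op -> op) : Prop := forall x, LBoo R x ->
  [/\ LBoo R (a x), sot_cvg (fun n => Ad_left (ascending n) x) (a x),
      forall t, coef (a x) (sh t) = coef x t &
      forall s, ~ range sh s -> coef (a x) s = 0].

Section ShiftEndomorphism.
Variable alpha : op -> op.
Hypothesis alpha_spec : shift_spec alpha.

Lemma alpha_ext x y : LBoo R x -> LBoo R y ->
  (forall t, coef y (sh t) = coef x t) ->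
  (forall s, ~ range sh s -> coef y s = 0) -> alpha x = y.
Proof.
move=> xL yL yx y0; have [axL _ ax ax0] := alpha_spec xL.
apply: LBoo_ext => // s; have [[t _ <-]|ns] := pselect (range sh s).
  by rewrite ax yx.
by rewrite ax0// y0.
Qed.

Lemma alpha_left t : alpha (L t) = L (sh t).
Proof.
have LL s : LBoo R (L s) by apply: group_vN_left.
apply: alpha_ext => // [s|s ns]; rewrite !coef_left.
  by rewrite (inj_eq sh_inj).
by case: eqP => // st; case: ns; exists t.
Qed.

Lemma alpha_id : alpha (idfun : op) = idfun.
Proof.
rewrite -(left_regular1 R braid) alpha_left; congr L; exact: gmulf1.
Qed.

Lemma alpha_combination c x y : LBoo R x -> LBoo R y ->
  alpha (c *: x + y) = c *: alpha x + alpha y.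
Proof.
move=> xL yL; have [axL _ ax ax0] := alpha_spec xL.
have [ayL _ ay ay0] := alpha_spec yL.
apply: alpha_ext => [||t|s ns].
- exact: (vN_combination LBoo_von_neumann c xL yL).
- exact: (vN_combination LBoo_von_neumann c axL ayL).
- transitivity (c * coef x t + coef y t);
  last exact: esym (coef_combination _ _ _ _).
  by rewrite -(ax t) -(ay t); exact: coef_combination.
- apply: (etrans (coef_combination c (alpha x) (alpha y) s)).
  transitivity (c * 0 + 0); last by rewrite mulr0 addr0.
  by congr (c * _ + _); [exact: ax0|exact: ay0].
Qed.

Lemma alpha_adjoint x : LBoo R x -> alpha (adjoint x) = adjoint (alpha x).
Proof.
move=> xL; have [axL _ ax ax0] := alpha_spec xL.
have [xb xR] := (LBooP _).1 xL; have [axb axR] := (LBooP _).1 axL.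
apply: alpha_ext => [||t|s ns].
- exact: (vN_adjoint LBoo_von_neumann xL).
- exact: (vN_adjoint LBoo_von_neumann axL).
- by rewrite (coef_adjoint _ axb axR) (coef_adjoint _ xb xR) -gmulfV ax.
- rewrite (coef_adjoint _ axb axR) ax0 ?conjc0// => -[t _ ts]; apply: ns.
  by exists t^-1%g => //; rewrite -[s]invgK -ts; exact: gmulfV.
Qed.

(** Composition is jointly continuous for the strong topology on bounded
    sets. *)
Lemma alpha_comp x y : LBoo R x -> LBoo R y ->
  alpha (x \o y) = alpha x \o alpha y.
Proof.
move=> xL yL; have [axL axc _ _] := alpha_spec xL.
have [ayL ayc _ _] := alpha_spec yL.
have [xb _] := (LBooP _).1 xL; have [M M0 xM] := bounded_bound xb.
have [_ xyc _ _] := alpha_spec (vN_comp LBoo_von_neumann xL yL).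
rewrite -(sot_limE xyc); apply: sot_limE.
have -> : (fun n => Ad_left (ascending n) (x \o y)) =
    (fun n => Ad_left (ascending n) x \o Ad_left (ascending n) y).
  apply/funext => n; have [[[_ _ AdM _] _ _] _] := (Ad_left_automorphism R
    (ascending n)).1.
  exact: AdM.
exact: sot_comp M0 (Ad_left_bound _ xb M0 xM) axc ayc.
Qed.

Lemma alpha_trace x : LBoo R x -> canonical_trace (alpha x) = canonical_trace x.
Proof.
move=> /alpha_spec[_ _ ax _]; rewrite !trace_coef -(ax 1%g); congr coef.
by rewrite gmulf1.
Qed.

Lemma alpha_injective x y : LBoo R x -> LBoo R y -> alpha x = alpha y -> x = y.
Proof.
move=> xL yL; have [_ _ ax _] := alpha_spec xL;
  have [_ _ ay _] := alpha_spec yL.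
by move=> xy; apply: LBoo_ext => // t; rewrite -ax -ay xy.
Qed.

Lemma iter_alpha_LBoo n x : LBoo R x -> LBoo R (iter n alpha x).
Proof. by move=> xL; elim: n => //= n /alpha_spec[]. Qed.

Lemma iter_alpha_random_variable n (A B : set op) : A `<=` LBoo R ->
  (forall x, A x -> B (iter n alpha x)) ->
  Defs.random_variable canonical_trace A B (iter n alpha).
Proof.
move=> AL AB.
have itL m x : A x -> LBoo R (iter m alpha x) by move=> /AL;
  exact: iter_alpha_LBoo.
split; [split=> //| |].
- by move=> c x y Ax Ay; elim: n {AB} => //= n ->; rewrite alpha_combination;
  auto.
- by move=> x y Ax Ay; elim: n {AB} => //= n ->; rewrite alpha_comp; auto.
- by move=> x Ax; elim: n {AB} => //= n ->; rewrite alpha_adjoint; auto.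
- move=> x y /set_mem Ax /set_mem Ay; elim: n {AB} => //= n IH.
  by move=> /alpha_injective xy; apply: IH; apply: xy; exact: itL.
- by move=> x Ax; elim: n {AB} => //= n <-; rewrite alpha_trace; auto.
Qed.

Lemma sh_subgroup K : subgroup_set K -> subgroup_set (sh @` K).
Proof.
move=> [K1 KM KV]; split=> [|_ _ [s Ks <-] [t Kt <-]|_ [s Ks <-]].
- by exists 1%g => //; exact: gmulf1.
- by exists (s * t)%g; [exact: KM|rewrite gmulfM].
- by exists s^-1%g; [exact: KV|rewrite gmulfV].
Qed.

(** Surjectivity uses the limit of the inverse conjugations: on the range of the
    shift they are eventually constant as well, with the inverse of the shift
    as limit. *)
Lemma alpha_group_vN K : subgroup_set K ->
  alpha @` group_vN R K = group_vN R (sh @` K).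
Proof.
move=> KG; have shKG := sh_subgroup KG.
have sub J : subgroup_set J -> group_vN R J `<=` LBoo R.
  by move=> JG; apply: group_vN_mono.
apply/seteqP; split=> [_ [x xK <-]|y yK].
  have [axL _ ax ax0] := alpha_spec (sub _ KG _ xK).
  have [axb axR] := (LBooP _).1 axL; have [_ _ xs] := (group_vNP KG x).1 xK.
  apply/(group_vNP shKG); split=> // s Ks.
  have [[t _ ts]|ns] := pselect (range sh s); last exact: ax0.
  by rewrite -ts ax xs// => Kt; apply: Ks; exists t.
have [yb yR ys] := (group_vNP shKG y).1 yK.
(* the inverse of the shift, with value 1 outside its range *)
pose th s := xget 1%g [set t | sh t = s].
have thK t : th (sh t) = t.
  by rewrite /th; case: xgetP => [t' _ /= /sh_inj//|/(_ t) []].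
have supp s : coef y s != 0 -> exists2 t, K t & s = sh t.
  move=> s0; have [[t Kt <-]|Ks] := pselect ((sh @` K) s); first by exists t.
  by rewrite ys// eqxx in s0.
have wth s : coef y s != 0 -> exists N, forall n, (N <= n)%N ->
    ((ascending n)^-1 * s * (ascending n)^-1^-1)%g = th s.
  move=> /supp[t _ ->]; have [N NP] := ascending_conj_eventually t.
  by exists N => n /NP nt; rewrite thK -nt invgK !mulgA mulVg mul1g mulgVK.
have [x [xb xR _ x1 x0]] := Ad_limit yb yR wth.
have xy t : coef x t = coef y (sh t).
  have [t0|/x1] := eqVneq (coef y (sh t)) 0; last by rewrite thK.
  rewrite t0 x0// => s s0; apply/eqP => st; have [t' _ st'] := supp _ s0.
  by move: s0 st; rewrite st' thK => /[swap] ->; rewrite t0 eqxx.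
have xL : LBoo R x by apply/LBooP.
exists x.
  apply/(group_vNP KG); split=> // t Kt; rewrite xy.
  by apply: ys => -[t' Kt' /sh_inj tt']; apply: Kt; rewrite -tt'.
apply: alpha_ext => //; first exact: sub yK.
by move=> s ns; apply: ys => -[t _ ts]; apply: ns; exists t.
Qed.

Definition iter_sh k K : set braid := iter k sh @` K.

Lemma iter_sh_subgroup k K : subgroup_set K -> subgroup_set (iter_sh k K).
Proof.
move=> KG; rewrite /iter_sh; elim: k => [|k IH]; first by rewrite image_id.
rewrite (_ : _ @` K = sh @` (iter k sh @` K)); first exact: sh_subgroup.
by rewrite -image_comp.
Qed.

End ShiftEndomorphism.

Lemma alpha_shift_spec : shift_spec (@alpha R).
Proof.
move=> x /LBooP[xb xR].
have [y [yb yR yc y1 y0]] := Ad_limit xb xR (fun t _ =>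
  ascending_conj_eventually t).
have -> : alpha x = y by exact: sot_limE.
split=> //; first exact/LBooP.
  move=> t; have [t0|/y1//] := eqVneq (coef x t) 0.
  rewrite t0 y0// => s s0; apply: contra_neq s0 => /sh_inj ->.
  by rewrite t0.
by move=> s sh_s; apply: y0 => t _; apply/eqP => ts; apply: sh_s; exists t.
Qed.

Lemma alpha_image_group_vN k K : subgroup_set K ->
  alpha_image k (group_vN R K) = group_vN R (iter_sh k K).
Proof.
move=> KG; rewrite /alpha_image /iter_sh; elim: k => [|k IH].
  by rewrite !image_id.
rewrite (_ : _ @` K = sh @` (iter k sh @` K)); last by rewrite -image_comp.
rewrite -(alpha_group_vN alpha_shift_spec); last exact: iter_sh_subgroup.
by rewrite -IH -image_comp.
Qed.

End BraidShift.

(** * Fixed points, tower, independence and moments *)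

Section Conclusions.
Variable R : realType.
Local Notation H := (l2 R braid).
Local Notation op := (H -> H).
Local Notation L := (@left_regular R braid).
Implicit Types (x y : op) (t s : braid) (K : set braid).

Lemma braid_sub_subgroup n : subgroup_set (braid_sub n).
Proof. exact: generated_subgroup_group. Qed.

Lemma LB_LBoo n : LB R n `<=` LBoo R.
Proof. exact: group_vN_mono (braid_sub_subgroup n) (@subgroup_setT _) _. Qed.

Lemma fixed_algebraP K x : fixed_algebra (LBoo R) Ad_left K x <->
  LBoo R x /\ forall s, K s -> forall t, coef x (s^-1 * t * s)%g = coef x t.
Proof.
split=> -[xL xK]; split=> // s Ks; have [xb xR] := (LBooP x).1 xL.
  by move=> t; rewrite -{2}(xK s Ks) coef_Ad_left.
apply: LBoo_ext => //; first exact: Ad_left_group_vN.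
by move=> t; rewrite coef_Ad_left// xK.
Qed.

(** The orbit [O] of an element [t] of the support is finite, so it lies in some
    [braid_sub N].  Since [O] is also stable under conjugation by [sigma N.-1]
    as long as this generator belongs to the tail, [N] can be lowered down to
    [n.+1]. *)
Lemma fixed_algebra_tail n :
  fixed_algebra (LBoo R) Ad_left (braid_tail n.+2) = LB R n.+1.
Proof.
have tailG : subgroup_set (braid_tail n.+2) by exact: generated_subgroup_group.
have [_ _ tailV] := tailG; have BG := braid_sub_subgroup n.+1.
have comm s t : braid_tail n.+2 s -> braid_sub n.+1 t -> (s^-1 * t * s)%g = t.
  move=> sT tB; rewrite -mulgA (_ : t * s = s * t)%g ?mulKg//.
  by apply: (@parabolic_commute _ _ t s _ tB sT) => i j /=; lia.
apply/seteqP; split=> [x /fixed_algebraP[xL xf]|x xB]; last first.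
  apply/fixed_algebraP; split=> [|s sT t]; first exact: LB_LBoo xB.
  have [_ _ xs] := (group_vNP BG x).1 xB.
  have [tB|tB] := pselect (braid_sub n.+1 t); first by rewrite comm.
  rewrite [RHS]xs// xs// => tB'; apply: tB; move: (tB').
  rewrite -(comm s^-1%g _ (tailV _ sT) tB').
  by rewrite invgK !mulgA mulgV mul1g mulgK.
have [xb xR] := (LBooP x).1 xL.
apply/(group_vNP BG); split=> // t tB; apply: contrapT => /eqP t0; apply: tB.
pose O : set braid := [set s * t * s^-1 | s in braid_tail n.+2]%g.
have Ofin : finite_set O.
  apply: sub_finite_set (level_set_finite (x (delta R 1%g)) t0).
  move=> _ [s sT <-]; rewrite /= -[LHS]/(coef x _).
  by rewrite -(xf s sT) !mulgA mulVg mul1g mulgVK.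
have [N ON] : exists N, O `<=` braid_sub N.
  have [q ->] := (finite_seqP O).1 Ofin; elim: q => [|s q [N qN]].
    by exists 0%N.
  have [M sM] := braid_sub_exists s; exists (maxn M N) => g /=.
  rewrite inE => /predU1P[->|gq].
    exact: braid_sub_leq (leq_maxl _ _) _ sM.
  by apply: braid_sub_leq (leq_maxr _ _) _ _; exact: qN.
have Ot : O t.
  by exists 1%g; [have [] := tailG|rewrite mul1g invg1 mulg1].
elim: N ON => [|N IH] ON; first by apply: braid_sub_leq (leq0n _) _ _;
  exact: ON.
have [Nn|nN] := leqP N.+1 n.+1; first by apply: braid_sub_leq Nn _ _; exact: ON.
apply: IH => z Oz; apply: sigma_conj_drop; first exact: ON.
apply: ON; have [s sT <-] := Oz; exists (sigma N * s)%g.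
  have [_ TM _] := tailG; apply: TM => //; apply: sub_generated_subgroup.
  by exists N.
by rewrite invgM !mulgA.
Qed.

Lemma fixed_algebra_all :
  fixed_algebra (LBoo R) Ad_left [set: braid] = @scalar_ops R braid.
Proof.
have BG := braid_sub_subgroup 1.
have scalarL (c : R[i]) : LBoo R (fun u => c *: u).
  have -> : (fun u : H => c *: u) = c *: idfun + 0 by rewrite addr0.
  have vL := LBoo_von_neumann R; apply: (vN_combination vL); first exact: vN_id.
  by rewrite -(subrr (idfun : op)) -scaleN1r addrC;
    apply: (vN_combination vL); exact: vN_id.
apply/seteqP; split=> [x [xL xf]|_ [c ->]]; last first.
  apply/fixed_algebraP; split=> [|s _ t]; first exact: scalarL.
  transitivity (c * (s^-1 * t * s == 1 :> braid)%g%:R) => //.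
  transitivity (c * (t == 1 :> braid)%g%:R) => //.
  rewrite -(inj_eq (mulgI s^-1%g) t 1%g) -(inj_eq (mulIg s) _ (s^-1 * 1)%g).
  by rewrite mulg1 mulVg.
have : LB R 1 x.
  by rewrite -fixed_algebra_tail; split=> // s _; exact: xf.
move=> /(group_vNP BG)[xb xR xs].
exists (coef x 1%g); apply: LBoo_ext => [//||t]; first exact: scalarL.
transitivity (coef x 1%g * (t == 1%g)%:R) => //.
have [->|/eqP t1] := eqVneq t 1%g; first by rewrite mulr1.
rewrite mulr0; apply: xs => tB; apply: t1; apply: parabolic0.
by apply: parabolic_sub tB => k.
Qed.

Lemma Ad_generating : generating_property (@Ad_left R braid).
Proof.
rewrite /generating_property.
rewrite /LBoo -{2}parabolic_top; apply: vN_generated_group.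
  by rewrite -/(parabolic setT) parabolic_top => x [n _ []].
move=> _ [k _ <-]; exists k.+3 => //; rewrite fixed_algebra_tail.
by apply: group_vN_left; apply: parabolic_sigma; exact: ltnSn.
Qed.

Lemma Ad_representation : representation (LBoo R) (@Ad_left R braid).
Proof.
by split=> [s|s t x _]; [exact: Ad_left_automorphism|exact: Ad_leftM].
Qed.

Lemma braid_sub_sh m : sh @` braid_sub m `<=` braid_sub m.+1.
Proof. by rewrite sh_parabolic; apply: parabolic_sub => _ [k km <-]. Qed.

Lemma braid_sub_sh_meet m : range sh `&` braid_sub m.+1 `<=` sh @` braid_sub m.
Proof.
move=> x [xs xB]; rewrite sh_parabolic.
apply: parabolic_sub (parabolic_range_sh xB xs) => -[|k] [/= km k0] //.
by exists k.
Qed.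

Lemma iter_sh_mono k J K : J `<=` K -> iter_sh k J `<=` iter_sh k K.
Proof. exact: image_subset. Qed.

Lemma iter_shS k K : iter_sh k.+1 K = iter_sh k (sh @` K).
Proof.
by rewrite /iter_sh image_comp; congr (_ @` _); apply/funext => x /=;
  rewrite -iterSr.
Qed.

Lemma iter_sh_meet k J K : iter_sh k J `&` iter_sh k K `<=` iter_sh k (J `&` K).
Proof.
have sh_k_inj : injective (iter k sh) by elim: (k) => // m IH s t /sh_inj/IH.
by move=> _ [[s Js <-] [t Kt /sh_k_inj ts]]; exists s => //; rewrite -ts;
  split=> //; rewrite ts.
Qed.

(** Everything is the image under the [k]-th power of the shift of a
    configuration in which the only inclusion that is not obvious says that a shift in
    [braid_sub m.+1] is the shift of an element of [braid_sub m]. *)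
Lemma tower_square k m J K : subgroup_set J -> subgroup_set K ->
  braid_sub m.+1 `<=` J -> sh @` K `<=` J -> braid_sub m `<=` K ->
  commuting_square canonical_trace
    (alpha_image k (LB R m.+1)) (alpha_image k (group_vN R J))
    (alpha_image k.+1 (LB R m)) (alpha_image k.+1 (group_vN R K)).
Proof.
move=> JG KG BJ KJ BK; rewrite !alpha_image_group_vN//;
  try exact: braid_sub_subgroup.
rewrite !iter_shS; apply: group_vN_commuting_square.
- exact: iter_sh_subgroup.
- by apply: iter_sh_subgroup; exact: sh_subgroup.
- by apply: iter_sh_subgroup; exact: braid_sub_subgroup.
- by apply: iter_sh_subgroup; apply: sh_subgroup; exact: braid_sub_subgroup.
- exact: iter_sh_mono.
- exact: iter_sh_mono.
- by apply: iter_sh_mono; exact: image_subset.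
- by apply: iter_sh_mono; exact: braid_sub_sh.
- apply: subset_trans (@iter_sh_meet _ _ _) _; apply: iter_sh_mono.
  move=> x [[y _ yx] xB]; apply: braid_sub_sh_meet; split=> //.
  by exists y.
Qed.

Lemma tower_cells k m : tower_cell R k m /\ tower_right_cell R k m.
Proof.
split; apply: tower_square => //; try exact: braid_sub_subgroup.
- exact: braid_sub_leq.
- exact: braid_sub_sh.
- exact: braid_sub_leq.
Qed.

Lemma iter_sh_parabolic k I :
  iter_sh k (parabolic I) = parabolic [set (k + i)%N | i in I].
Proof.
elim: k => [|k IH] in I *.
  rewrite /iter_sh image_id; congr parabolic.
  by apply/seteqP; split=> [i Ii|_ [i Ii <-]//]; exists i.
rewrite iter_shS sh_parabolic IH; congr parabolic; apply/seteqP; split.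
  by move=> _ [_ [i Ii <-] <-]; exists i => //; rewrite addnS.
by move=> _ [i Ii <-]; exists i.+1; [exists i|rewrite addnS].
Qed.

Lemma iter_alpha_LB2 n : iter n (@alpha R) @` LB R 2 =
  group_vN R (parabolic [set n]).
Proof.
rewrite -/(alpha_image n (LB R 2)) alpha_image_group_vN;
  last exact: braid_sub_subgroup.
rewrite iter_sh_parabolic; congr (group_vN R (parabolic _)); apply/seteqP;
  split.
  by move=> _ [[|i]//= _ <-]; rewrite addn0.
by move=> _ ->; exists 0%N; rewrite ?addn0.
Qed.

Lemma vN_generated_iter_alpha (I : set nat) :
  vN_generated (\bigcup_(i in I) (iter i (@alpha R) @` LB R 2)) =
  group_vN R (parabolic I).
Proof.
apply: vN_generated_group => [x [i Ii]|_ [i Ii <-]].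
  rewrite iter_alpha_LB2; apply: group_vN_mono => //.
  - exact: generated_subgroup_group.
  - exact: generated_subgroup_group.
  - by apply: parabolic_sub => _ ->.
exists i => //; rewrite iter_alpha_LB2.
by apply: group_vN_left; apply: parabolic_sigma.
Qed.

Lemma iter_alpha_independent :
  full_independent canonical_trace (fun n => iter n (@alpha R) @` LB R 2).
Proof.
move=> I J IJ x y; rewrite !vN_generated_iter_alpha => xI yJ.
apply: trace_comp_independent xI yJ.
- exact: generated_subgroup_group.
- exact: generated_subgroup_group.
- by move=> s sI sJ; exact: parabolic_disjoint sI sJ.
Qed.

Lemma sigma_neq1 k : sigma k <> 1%g.
Proof.
move=> /(braid_classP [:: (k, false)] [::]).2 /strand_end_eq /(_ k) /=.
by rewrite /cross eqxx; lia.
Qed.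

Lemma sigma_inj i j : sigma i = sigma j -> i = j.
Proof.
move=> ij; apply: contrapT => nij; apply: (@sigma_neq1 i).
apply: (@parabolic_disjoint [set i] [set j]).
- by apply/seteqP; split=> // k [-> /nij].
- exact: parabolic_sigma.
- by rewrite ij; exact: parabolic_sigma.
Qed.

Section Moments.
Variable alpha : op -> op.
Hypothesis alpha_spec : shift_spec alpha.
Local Notation iota := (fun n : nat => iter n alpha).

Lemma iter_alpha_id k : iter k alpha idfun = idfun.
Proof. by elim: k => //= k ->; exact: alpha_id. Qed.

Lemma iter_alpha_big n k (F : 'I_n -> op) : (forall l, LBoo R (F l)) ->
  LBoo R (\big[comp/idfun]_(l < n) F l) /\
  iter k alpha (\big[comp/idfun]_(l < n) F l) =
    \big[comp/idfun]_(l < n) iter k alpha (F l).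
Proof.
have vL := LBoo_von_neumann R.
move=> FL; elim/big_rec2: _ => [|l x y _ [yL <-]].
  by split; [exact: vN_id|exact: iter_alpha_id].
have [[_ _ M _] _ _] := @iter_alpha_random_variable _ _ alpha_spec k _ (LBoo R)
  (@subset_refl _ (LBoo R)) (@iter_alpha_LBoo _ _ alpha_spec k).
by split; [exact: (vN_comp vL (FL l) yL)|exact: (M _ _ (FL l) yL)].
Qed.

Lemma iter_alpha_trace k x : LBoo R x ->
  canonical_trace (iter k alpha x) = canonical_trace x.
Proof.
move=> xL; have [_ _ ] := @iter_alpha_random_variable _ _ alpha_spec k _ (LBoo
  R)
  (@subset_refl _ (LBoo R)) (@iter_alpha_LBoo _ _ alpha_spec k).
exact.
Qed.

Lemma iter_alpha_stationary (A : set op) : A `<=` LBoo R ->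
  stationary canonical_trace A iota.
Proof.
move=> AL n i j k ij a aA; rewrite /moment.
have jL l : LBoo R (iter (j l) alpha (a l)).
  by apply: (iter_alpha_LBoo alpha_spec); exact: AL.
have [bL bE] := iter_alpha_big k jL.
rewrite -(iter_alpha_trace k bL) bE; congr canonical_trace.
by apply: eq_bigr => l _; rewrite ij addnC iterD.
Qed.

Lemma iter_alpha_left k s : iter k alpha (L s) = L (iter k sh s).
Proof. by elim: k => //= k ->; exact: alpha_left. Qed.

Lemma moment_left n (i : 'I_n -> nat) (g : 'I_n -> braid) :
  moment canonical_trace iota i (fun l => L (g l)) =
  ((1 : braid) == \big[*%g/1]_(l < n) iter (i l) sh (g l) :> braid)%g%:R.
Proof.
rewrite /moment (_ : \big[comp/idfun]_(l < n) _ =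
    L (\big[*%g/1%g]_(l < n) iter (i l) sh (g l))).
  by rewrite trace_coef coef_left.
elim/big_rec2: _ => [|l x y _ ->]; first by rewrite left_regular1.
by rewrite iter_alpha_left left_regularM.
Qed.

(** The word [s0 s1 s0 s1^-1 s0^-1 s1^-1] is trivial, whereas with [s2] in place
    of [s1] it equals [s0 s2^-1].  A transposition of the indices 1 and 2 is
    order preserving on 0 and 1. *)
Lemma iter_alpha_not_spreadable :
  ~ spreadable canonical_trace (LB R 2) iota.
Proof.
pose s0 := sigma 0.
pose g (l : 'I_6) : braid := if (l < 3)%N then s0 else (s0^-1)%g.
pose j (l : 'I_6) : nat := odd l.
pose p (k : nat) : nat := if k == 1 then 2 else if k == 2 then 1 else k.
have pK : involutive p by move=> [|[|[|k]]].
have s0B : braid_sub 2 s0 by exact: parabolic_sigma.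
have BG := braid_sub_subgroup 2.
have gB l : LB R 2 (L (g l)).
  apply: group_vN_left; rewrite /g; case: ifP => // _.
  by have [_ _ BV] := BG; exact: BV.
move=> /(_ 6%N (p \o j) j p) sp.
have fp : finite_permutation p.
  by split; [exists p|exists 3%N => -[|[|[|k]]]].
have pj k l : (j k < j l)%N -> (p (j k) < p (j l))%N.
  by rewrite /j; case: (odd k); case: (odd l).
have := sp fp pj (fun=> erefl) (fun l => L (g l)) gB; rewrite !moment_left.
rewrite !big_ord_recl !big_ord0 /g /j /p /= mulg1.
have shV t : sh t^-1%g = (sh t)^-1%g by exact: gmulfV.
rewrite !shV /s0 !sh_sigma => sp6.
move: sp6; rewrite mulg1.
have -> : (sigma 0 * (sigma 1 * (sigma 0 * ((sigma 1)^-1 *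
    ((sigma 0)^-1 / sigma 1)))))%g = 1%g :> braid.
  by rewrite !mulgA sigma_braid !mulgK mulgV.
have -> : (sigma 0 * (sigma 2 * (sigma 0 * ((sigma 2)^-1 *
    ((sigma 0)^-1 / sigma 2)))))%g = (sigma 0 / sigma 2)%g :> braid.
  by rewrite (mulgA (sigma 2) (sigma 0)) -sigma_commute_far// !mulgA !mulgK.
rewrite eqxx; case: eqP => [e _|_ /esym/eqP]; last by rewrite oner_eq0.
have /sigma_inj// : sigma 0 = sigma 2.
by apply: (mulIg (sigma 2)^-1%g); rewrite -e mulgV.
Qed.

End Moments.

End Conclusions.

Theorem theorem5p6 (R : realType) :
  let rho := @Ad_left R braid in
  let iota := fun n : nat => iter n (@alpha R) in
  representation (LBoo R) rho /\
  (* (i) *)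
  generating_property rho /\
  (* (ii) *)
  fixed_algebra (LBoo R) rho [set: braid] = @scalar_ops R braid /\
  (* (iii) *)
  (forall n : nat, fixed_algebra (LBoo R) rho (braid_tail n.+2) = LB R n.+1) /\
  (* (iv) *)
  ((forall x, LBoo R x ->
      sot_cvg (fun n => rho (\big[*%g/1%g]_(k < n) sigma k) x) (alpha x)) /\
   endomorphism canonical_trace (LBoo R) (@alpha R) /\
   (forall tau : braid,
      alpha (@left_regular R braid tau) = left_regular (sh tau))) /\
  (* (v) *)
  (forall k m : nat, tower_cell R k m /\ tower_right_cell R k m) /\
  (* (vi) *)
  (random_sequence canonical_trace (LB R 2) (LBoo R) iota /\
   stationary canonical_trace (LB R 2) iota /\
   full_independent canonical_trace (fun n => iota n @` LB R 2) /\
   full_bernoulli_shift canonical_trace (LB R 2) (@alpha R)) /\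
  (* (vii) *)
  ~ spreadable canonical_trace (LB R 2) iota.
Proof.
move=> rho iota; have spec := alpha_shift_spec (R := R).
have endo : endomorphism canonical_trace (LBoo R) (@alpha R).
  split; last exact: alpha_id spec.
  apply: (@iter_alpha_random_variable _ _ spec 1%N) => // x.
  exact: (@iter_alpha_LBoo _ _ spec 1%N).
split; first exact: Ad_representation.
split; first exact: Ad_generating.
split; first exact: fixed_algebra_all.
split; first exact: fixed_algebra_tail.
split.
  split; first by move=> x /spec[].
  by split=> // tau; exact: alpha_left spec tau.
split; first exact: tower_cells.
split; last exact: iter_alpha_not_spreadable spec.
split.
  move=> n; apply: (iter_alpha_random_variable spec); first exact: LB_LBoo.
  by move=> x /LB_LBoo; exact: iter_alpha_LBoo spec _ _.
split; first by apply: (iter_alpha_stationary spec); exact: LB_LBoo.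
split; first exact: iter_alpha_independent.
split; last exact: iter_alpha_independent.
by rewrite vN_generated_iter_alpha parabolic_top.
Qed.
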